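(* The poset of many-one degrees of computably transparent, inflationary, idempotent partial multimaps on $\mathbf N$ is isomorphic to the poset of Turing–Weihrauch degrees of partial multimaps on $\mathbf N$.
   Context: Let $(\mathsf N,\mathbf N,\ast)$ be one of: (i) Kleene's first algebra: $\mathsf N=\mathbf N=\mathbb N$, $e\ast n=\varphi_e(n)$ for the standard indexing of partial computable functions on $\mathbb N$; (ii) Kleene's second algebra: $\mathsf N=\mathbf N=\mathbb N^{\mathbb N}$, $x\ast y=\varphi_x(y)$ for the standard indexing $(\varphi_x)_{x\in\mathbb N^{\mathbb N}}$ of partial continuous functions on Baire space (e.g. $(x\ast y)(n)=x(\langle n,y(0),\dots,y(k-1)\rangle)-1$ for the least $k$ making $x(\cdots)>0$; $x\ast y$ is defined iff such $k$ exists for all $n$); (iii) the Kleene–Vesley algebra: $\mathbf N=\mathbb N^{\mathbb N}$ with $\ast$ as in (ii) and $\mathsf N$ the set of computable elements of $\mathbb N^{\mathbb N}$. Write $\varphi_x(y)=x\ast y$, $x\ast y\ast z=(x\ast y)\ast z$, and $x\ast A=\{x\ast a:a\in A\}$ for $A\subseteq\mathbf N$ (defined iff $x\ast a$ is defined for all $a\in A$). A partial function on $\mathbf N$ is computable if for some $e\in\mathsf N$ it agrees with $\varphi_e$ on its domain. Pairs and finite sequences of elements of $\mathbf N$ are coded in $\mathbf N$ in a standard computable way. A partial multimap on $\mathbf N$ is a partial function $f$ from $\mathbf N$ to $\mathcal P(\mathbf N)$ (the value $\emptyset$ is allowed and is distinguished from being undefined). The composition $g\circ f$ has $x\in\mathrm{dom}(g\circ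 f)$ iff $x\in\mathrm{dom}(f)$ and $f(x)\subseteq\mathrm{dom}(g)$, and then $(g\circ f)(x)=\bigcup\{g(y):y\in f(x)\}$. Many-one reducibility: $f\leq_m g$ iff there is a computable $\varphi$ such that for all $x\in\mathrm{dom}(f)$, $\varphi(x)$ is defined, $\varphi(x)\in\mathrm{dom}(g)$ and $g(\varphi(x))\subseteq f(x)$. $U$ is computably transparent if there is $u\in\mathsf N$ such that for all $a,x\in\mathbf N$, whenever $a\ast U(x)$ is defined (i.e. $x\in\mathrm{dom}(U)$ and $a\ast y$ is defined for every $y\in U(x)$), $u\ast a\ast x\in\mathrm{dom}(U)$ and $U(u\ast a\ast x)\subseteq a\ast U(x)$. $U$ is inflationary if there is $\eta\in\mathsf N$ such that for all $x\in\mathbf N$, $\eta\ast x\in\mathrm{dom}(U)$ and $U(\eta\ast x)\subseteq\{x\}$. $U$ is idempotent if there is $\mu\in\mathsf N$ such that for all $x\in\mathrm{dom}(U\circ U)$, $\mu\ast x\in\mathrm{dom}(U)$ and $U(\mu\ast x)\subseteq (U\circ U)(x)$. Turing–Weihrauch reducibility (also called generalized Weihrauch reducibility). For partial multimaps $f,g$, consider the perfect information game $\mathfrak G(f,g)$ between Oracle and Computer. Oracle first plays $z_0\in\mathrm{dom}(f)$. At round $n\ge 0$ Computer plays $\langle A_n,x_n\rangle$ with $A_n\in\{\mathtt{Query},\mathtt{Halt}\}$ and $x_n\in\mathbf N$. If $A_n=\mathtt{Query}$, the rules require $x_n\in\mathrm{dom}(g)$, and then Oracle must answer with some $z_{n+1}\in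 g(x_n)$; if $A_n=\mathtt{Halt}$ the game terminates. Computer wins if Oracle violates the rules before Computer does, or if Computer obeys the rules and at some round halts with $x_n\in f(z_0)$ (in particular an infinite rule-obeying play is not won by Computer). A strategy of Computer is a partial map $\tau$ from $\mathbf N^{<\omega}$ to $\{\mathtt{Query},\mathtt{Halt}\}\times\mathbf N$, giving $\langle A_n,x_n\rangle=\tau(z_0,\dots,z_n)$; being undefined counts as a rule violation. Oracle's moves are arbitrary. $\tau$ is winning if Computer wins every play following $\tau$. $f\leq_{TW}g$ iff Computer has a computable winning strategy in $\mathfrak G(f,g)$. Degrees are equivalence classes of the preorder, with the induced partial order. *)

(* Defs.v *)
From mathcomp Require Import all_boot.
From mathcomp Require Import boolp classical_sets.
From Stdlib Require Cantor.

Set Implicit Arguments.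
Unset Strict Implicit.
Unset Printing Implicit Defensive.

Local Open Scope classical_set_scope.

(** Partial functions are [option]-valued.  [opt_of R] is the value singled out
    by [R], if there is one; it is only applied to relations [R] that hold of
    at most one value. *)
Definition opt_of (T : Type) (R : T -> Prop) : option T :=
  if pselect (exists y, R y) is left h then Some (sval (cid h)) else None.

Lemma opt_ofP (T : Type) (R : T -> Prop) (y : T) :
  (forall a b, R a -> R b -> a = b) -> opt_of R = Some y <-> R y.
Proof.
move=> Runiq; rewrite /opt_of; case: pselect => [h|h].
  case: cid => v Rv /=; split=> [[<-] //|Ry].
  by rewrite (Runiq _ _ Rv Ry).
by split=> // Ry; case: h; exists y.
Qed.

Definition npair (a b : nat) : nat := Cantor.to_nat (a, b).

Lemma npair_inj a b a' b' : npair a b = npair a' b' -> a = a' /\ b = b'.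
Proof.
by move=> /(f_equal Cantor.of_nat); rewrite !Cantor.cancel_of_to => -[-> ->].
Qed.

Definition nseq_code : seq nat -> nat := foldr (fun a c => (npair a c).+1) 0.

(** [phi e n m] means that the partial computable function with index [e] maps
    [n] to [m].  An index is a pair (tag, operands), with one tag for each
    scheme generating the unary partial recursive functions: zero, successor,
    the two projections of the pairing, pairing of functions, composition,
    primitive recursion and unbounded minimization.  An index whose tag is
    larger than 7 is an index of the empty function. *)
Inductive phi : nat -> nat -> nat -> Prop :=
| phi_zero p n : phi (npair 0 p) n 0
| phi_succ p n : phi (npair 1 p) n n.+1
| phi_fst p a b : phi (npair 2 p) (npair a b) a
| phi_snd p a b : phi (npair 3 p) (npair a b) b
| phi_pair c d n a b :
    phi c n a -> phi d n b -> phi (npair 4 (npair c d)) n (npair a b)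
| phi_comp c d n a b :
    phi d n a -> phi c a b -> phi (npair 5 (npair c d)) n b
| phi_rec0 c d a b :
    phi c a b -> phi (npair 6 (npair c d)) (npair a 0) b
| phi_recS c d a k r b :
    phi (npair 6 (npair c d)) (npair a k) r ->
    phi d (npair a (npair k r)) b ->
    phi (npair 6 (npair c d)) (npair a k.+1) b
| phi_mu c a k (v : nat -> nat) :
    (forall j, j < k -> phi c (npair a j) (v j).+1) ->
    phi c (npair a k) 0 -> phi (npair 7 c) a k.

Lemma phi_functional e n m m' : phi e n m -> phi e n m' -> m = m'.
Proof.
move=> H; move: {1 3}e (erefl e) {1 3}n (erefl n) => e' Ee n' En H'.
elim: H e' Ee n' En m' H' => {e n m} [p n|p n|p a b|p a b|c d n a b _ IHa _ IHb
  |c d n a b _ IHa _ IHb|c d a b _ IHb|c d a k r b _ IHr _ IHb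
  |c a k v Hv IHv Hk IHk] e' Ee n' En m' H';
  case: e' n' m' / H' Ee En => [p' n'|p' n'|p' a' b'|p' a' b'
  |c' d' n' a' b' Ha Hb|c' d' n' a' b' Ha Hb|c' d' a' b' Hb
  |c' d' a' k' r' b' Hr Hb|c' a' k' v' Hv' Hk'] /npair_inj[] // _ Ee En.
- by rewrite En.
- by case: (npair_inj En).
- by case: (npair_inj En).
- case: (npair_inj Ee) => Ec Ed.
  by rewrite (IHa _ Ec _ En _ Ha) (IHb _ Ed _ En _ Hb).
- case: (npair_inj Ee) => Ec Ed; have Ea := IHa _ Ed _ En _ Ha.
  exact: (IHb _ Ec _ (esym Ea) _ Hb).
- case: (npair_inj Ee) => Ec _; case: (npair_inj En) => Ea _.
  exact: (IHb _ Ec _ Ea _ Hb).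
- by case: (npair_inj En).
- by case: (npair_inj En).
- case: (npair_inj Ee) => Ec Ed; case: (npair_inj En) => Ea [Ek].
  have Er : r = r' by apply: IHr Hr; congr npair.
  by apply: IHb Hb; rewrite ?Ea ?Ek ?Er.
- case: (ltngtP k k') => // lt.
  + by have := IHk c' Ee _ (f_equal (npair^~ k) En) _ (Hv' _ lt).
  + by have := IHv _ lt c' Ee _ (f_equal (npair^~ k') En) _ Hk'.
Qed.

Definition total_computable (x : nat -> nat) : Prop :=
  exists e, forall n, phi e n (x n).

(** The partial continuous function on Baire space with index [x] maps [y] to
    [z]. *)
Definition baire_phi (x y z : nat -> nat) : Prop :=
  forall n, exists k,
    x (nseq_code (n :: mkseq y k)) = (z n).+1 /\
    (forall j, j < k -> x (nseq_code (n :: mkseq y j)) = 0).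

Lemma baire_phi_functional x y z z' :
  baire_phi x y z -> baire_phi x y z' -> z = z'.
Proof.
move=> H H'; apply/funext => n.
have [k [Hk Lk]] := H n; have [k' [Hk' Lk']] := H' n.
case: (ltngtP k k') => [lt|lt|E].
- by rewrite Lk' in Hk.
- by rewrite Lk in Hk'.
- by move: Hk; rewrite E Hk' => -[].
Qed.

(** [computable_elt] is the set written N in sans serif, [carrier] the set
    written N in bold. *)
Record algebra := Algebra {
  carrier :> Type;
  app : carrier -> carrier -> option carrier;
  computable_elt : set carrier;
  pair_code : carrier -> carrier -> carrier;
  num : nat -> carrier
}.

Arguments computable_elt : clear implicits.
Arguments num : clear implicits.

Notation "x <*> y" := (app x y) (at level 40, left associativity).

Definition kleene_first : algebra :=
  Algebra (fun e n => opt_of (phi e n)) setT npair id.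

Definition baire_app (x y : nat -> nat) : option (nat -> nat) :=
  opt_of (baire_phi x y).

Definition baire_pair (x y : nat -> nat) : nat -> nat :=
  fun n => npair (x n) (y n).

Definition kleene_second : algebra :=
  Algebra baire_app setT baire_pair (fun k => fun=> k).

Definition kleene_vesley : algebra :=
  Algebra baire_app total_computable baire_pair (fun k => fun=> k).

Section Multimaps.
Variable A : algebra.

Definition seq_code : seq A -> A :=
  foldr (fun x c => pair_code (num A 1) (pair_code x c))
        (pair_code (num A 0) (num A 0)).

Definition app2 (x y z : A) : option A := obind (fun v => v <*> z) (x <*> y).

(** [x <*> b] must be defined for all [b] in [B], even if this is not needed to
    form the image. *)
Definition app_set (x : A) (B : set A) : option (set A) :=
  if `[< forall b, B b -> x <*> b >]
  then Some [set y | exists2 b, B b & x <*> b = Some y] else None.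

Definition computable (h : A -> option A) : Prop :=
  exists2 e, computable_elt A e & forall x y, h x = Some y -> e <*> x = Some y.

Definition multimap : Type := A -> option (set A).

Definition mdom (f : multimap) : set A := [set x | f x].

Definition mval (f : multimap) (x : A) : set A := odflt set0 (f x).

Definition mcomp (g f : multimap) : multimap := fun x =>
  if f x is Some B then
    if `[< B `<=` mdom g >] then Some (\bigcup_(y in B) mval g y) else None
  else None.

Definition many_one_le (f g : multimap) : Prop :=
  exists2 h : A -> option A, computable h &
  forall x, mdom f x ->
    exists y, [/\ h x = Some y, mdom g y & mval g y `<=` mval f x].

Definition computably_transparent (U : multimap) : Prop :=
  exists2 u, computable_elt A u &
  forall a x B, obind (app_set a) (U x) = Some B ->
    exists y, [/\ app2 u a x = Some y, mdom U y & mval U y `<=` B].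

Definition inflationary_mmap (U : multimap) : Prop :=
  exists2 eta, computable_elt A eta &
  forall x, exists y, [/\ eta <*> x = Some y, mdom U y & mval U y `<=` [set x]].

Definition idempotent_mmap (U : multimap) : Prop :=
  exists2 mu, computable_elt A mu &
  forall x, mdom (mcomp U U) x ->
    exists y,
      [/\ mu <*> x = Some y, mdom U y & mval U y `<=` mval (mcomp U U) x].

Inductive action := Query | Halt.

Definition move_code (m : action * A) : A :=
  pair_code (num A (if m.1 is Query then 0 else 1)) m.2.

Definition strategy : Type := seq A -> option (action * A).

Definition computable_strategy (tau : strategy) : Prop :=
  exists2 e, computable_elt A e &
  forall s m, tau s = Some m -> e <*> seq_code s = Some (move_code m).

Section Play.
Variables (f g : multimap) (tau : strategy).
(** Oracle's moves.  Only those made before the game ends matter. *)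
Variable z : nat -> A.

Definition computer_move (n : nat) : option (action * A) := tau (mkseq z n.+1).

Definition legal_query (n : nat) : Prop :=
  exists2 x, computer_move n = Some (Query, x) & mdom g x.

Definition oracle_legal (n : nat) : Prop :=
  if n is m.+1 then
    exists2 x, computer_move m = Some (Query, x) & mval g x (z n)
  else mdom f (z 0).

(** Oracle is to make the move [z n], and nobody has violated the rules yet. *)
Definition reaches (n : nat) : Prop :=
  forall m, m < n -> oracle_legal m /\ legal_query m.

Definition computer_wins : Prop :=
  exists2 n, reaches n &
    ~ oracle_legal n \/
    exists2 x, computer_move n = Some (Halt, x) & mval f (z 0) x.

End Play.

Definition turing_weihrauch_le (f g : multimap) : Prop :=
  exists2 tau, computable_strategy tau & forall z, computer_wins f g tau z.

End Multimaps.

(** Equivalence classes, within [P], of the preorder [le]. *)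
Definition degree (T : Type) (P : set T) (le : T -> T -> Prop) : Type :=
  {c : set T | exists2 f, P f & c = [set g | P g /\ le f g /\ le g f]}.

Definition degree_le (T : Type) (P : set T) (le : T -> T -> Prop)
    (c d : degree P le) : Prop :=
  exists f g, [/\ sval c f, sval d g & le f g].

Definition order_isomorphic (S T : Type)
    (leS : S -> S -> Prop) (leT : T -> T -> Prop) : Prop :=
  exists2 F : S -> T, bijective F & forall x y, leS x y <-> leT (F x) (F y).

Definition many_one_degree_le (A : algebra) (P : set (multimap A)) :=
  @degree_le _ P (@many_one_le A).

Definition turing_weihrauch_degree_le (A : algebra) :=
  @degree_le _ [set: multimap A] (@turing_weihrauch_le A).

(* Main.v *)
Require Import Defs.
From mathcomp Require Import all_boot.
From mathcomp Require Import boolp classical_sets.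
From Stdlib Require Cantor.

(** Call [U] closed if it is computably transparent, inflationary and idempotent.
    For a multimap [g] let [closure_mmap g] be defined on the codes [x] of
    computations with oracle [g] that halt whatever the oracle answers, and let it
    send [x] to the possible outputs.  This is the least closed multimap above [g]
    for many-one reducibility: an inequality [g <= U] with [U] closed is extended
    along the well-founded tree of [x], transparency carrying the rest of the
    computation through one query and idempotency merging two nested values of [U].
    A computable strategy in the game of [f] and [g] is, up to currying, a
    many-one reduction of [f] to [closure_mmap g]; a strategy is turned into a halting
    computation because a position from which it does not force a halt can be
    prolonged by the oracle to a play that the computer does not win.  Hence the
    Turing-Weihrauch order is the many-one order on closures, and it coincides
    with the many-one order on closed multimaps.

    The programs involved only need a combinatory structure [pca].  For Kleene's
    first algebra it rests on an abstract machine with a computable step function,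
    for Baire space on computable functions on finite prefixes. *)

Set Implicit Arguments.
Unset Strict Implicit.
Unset Printing Implicit Defensive.

Local Open Scope classical_set_scope.

(** * Total computable functions on encoded data *)

Definition cfst (n : nat) : nat := (Cantor.of_nat n).1.
Definition csnd (n : nat) : nat := (Cantor.of_nat n).2.

Lemma cfst_npair a b : cfst (npair a b) = a.
Proof. by rewrite /cfst /npair Cantor.cancel_of_to. Qed.

Lemma csnd_npair a b : csnd (npair a b) = b.
Proof. by rewrite /csnd /npair Cantor.cancel_of_to. Qed.

Lemma npairK n : npair (cfst n) (csnd n) = n.
Proof. by rewrite /npair /cfst /csnd -surjective_pairing Cantor.cancel_to_of. Qed.

Lemma leq_npairr a b : b <= npair a b.
Proof.
have /leP := Cantor.to_nat_non_decreasing a b.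
by apply: leq_trans; rewrite leq_addr.
Qed.

Definition idx_id := npair 4 (npair (npair 2 0) (npair 3 0)).

Lemma phi_id n : phi idx_id n n.
Proof. by rewrite -{1 2}(npairK n); apply: phi_pair; constructor. Qed.

Fixpoint idx_const (m : nat) : nat :=
  if m is m'.+1 then npair 5 (npair (npair 1 0) (idx_const m')) else npair 0 0.

Lemma phi_const m n : phi (idx_const m) n m.
Proof.
by elim: m => [|m IH] /=; [exact: phi_zero|apply: phi_comp IH _; constructor].
Qed.

Section TotalComputable.
Implicit Types f g : nat -> nat.

Lemma tc_id : total_computable id.
Proof. by exists idx_id; exact: phi_id. Qed.

Lemma tc_const m : total_computable (fun=> m).
Proof. by exists (idx_const m); exact: phi_const. Qed.

Lemma tc_comp f g :
  total_computable f -> total_computable g -> total_computable (f \o g).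
Proof.
move=> [c Hc] [d Hd]; exists (npair 5 (npair c d)) => n.
exact: phi_comp (Hd n) (Hc _).
Qed.

Lemma tc_succ f : total_computable f -> total_computable (fun n => (f n).+1).
Proof. by apply: (@tc_comp S); exists (npair 1 0) => n; constructor. Qed.

Lemma tc_cfst f : total_computable f -> total_computable (fun n => cfst (f n)).
Proof.
apply: (@tc_comp cfst); exists (npair 2 0) => n.
by rewrite -{1}(npairK n); constructor.
Qed.

Lemma tc_csnd f : total_computable f -> total_computable (fun n => csnd (f n)).
Proof.
apply: (@tc_comp csnd); exists (npair 3 0) => n.
by rewrite -{1}(npairK n); constructor.
Qed.

Lemma tc_npair f g : total_computable f -> total_computable g ->
  total_computable (fun n => npair (f n) (g n)).
Proof.
move=> [c Hc] [d Hd]; exists (npair 4 (npair c d)) => n.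
exact: phi_pair.
Qed.

(** The scheme with tag 6 recurses on the second component of its argument, so [n] is first sent to
    [npair n (f n)]. *)
Lemma tc_rec f g h :
  total_computable f -> total_computable g -> total_computable h ->
  total_computable (fun n =>
    nat_rect (fun=> nat) (g n) (fun k r => h (npair n (npair k r))) (f n)).
Proof.
move=> Hf [c Hc] [d Hd].
have [e He] := tc_npair tc_id Hf.
exists (npair 5 (npair (npair 6 (npair c d)) e)) => n.
apply: phi_comp (He n) _ => /=.
by elim: (f n) => [|k IH] /=; [exact: phi_rec0|apply: phi_recS IH _].
Qed.

End TotalComputable.

Class encoding (T : Type) := enc : T -> nat.
#[local] Instance enc_nat : encoding nat := id.
#[local] Instance enc_bool : encoding bool := nat_of_bool.
#[local] Instance enc_prod (S T : Type) (eS : encoding S) (eT : encoding T) :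
  encoding (S * T) := fun p => npair (enc p.1) (enc p.2).
(** On [seq nat] this unfolds to [nseq_code], so the prefixes coded in [baire_phi] are encodings in
    the present sense. *)
#[local] Instance enc_seq (T : Type) (eT : encoding T) : encoding (seq T) :=
  foldr (fun a c => (npair (enc a) c).+1) 0.

(* [F] is total even off the encodings, so that recursion may evaluate the branches
   that are not taken. *)
Definition cpt {X Y : Type} {eX : encoding X} {eY : encoding Y} (f : X -> Y) :=
  exists2 F, total_computable F & forall x, F (enc x) = enc (f x).

Section Cpt.
Context {E X Y Z : Type} {eE : encoding E} {eX : encoding X} {eY : encoding Y}
  {eZ : encoding Z}.

Lemma cpt_id : cpt (fun x : X => x).
Proof. by exists id; [exact: tc_id|]. Qed.

Lemma cpt_const (y : Y) : cpt (fun _ : X => y).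
Proof. by exists (fun=> enc y); [exact: tc_const|]. Qed.

Lemma cpt_comp (g : Y -> Z) (f : X -> Y) : cpt g -> cpt f -> cpt (fun x => g (f x)).
Proof.
move=> [G tG HG] [F tF HF]; exists (G \o F); first exact: tc_comp.
by move=> x /=; rewrite HF HG.
Qed.

Lemma cpt_pair (f : E -> X) (g : E -> Y) : cpt f -> cpt g -> cpt (fun x => (f x, g x)).
Proof.
move=> [F tF HF] [G tG HG]; exists (fun n => npair (F n) (G n)).
  exact: tc_npair.
by move=> x; rewrite HF HG.
Qed.

Lemma cpt_fst (f : E -> X * Y) : cpt f -> cpt (fun x => (f x).1).
Proof.
move=> [F tF HF]; exists (fun n => cfst (F n)); first exact: tc_cfst.
by move=> x; rewrite HF cfst_npair.
Qed.

Lemma cpt_snd (f : E -> X * Y) : cpt f -> cpt (fun x => (f x).2).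
Proof.
move=> [F tF HF]; exists (fun n => csnd (F n)); first exact: tc_csnd.
by move=> x; rewrite HF csnd_npair.
Qed.

Lemma cpt_enc : cpt (enc : X -> nat).
Proof. by exists id; [exact: tc_id|]. Qed.

Lemma cpt_rec (n : E -> nat) (b : E -> X) (s : E -> nat -> X -> X) :
  cpt n -> cpt b -> cpt (fun p : E * (nat * X) => s p.1 p.2.1 p.2.2) ->
  cpt (fun x => nat_rect (fun=> X) (b x) (s x) (n x)).
Proof.
move=> [F tF HF] [G tG HG] [H tH HH]; exists (fun n =>
    nat_rect (fun=> nat) (G n) (fun k r => H (npair n (npair k r))) (F n)).
  exact: tc_rec.
move=> x; rewrite HF /enc /enc_nat.
elim: (n x) => [|k IH] /=; first exact: HG.
by rewrite IH; exact: (HH (x, (k, _))).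
Qed.

Lemma cpt_iter (n : E -> nat) (b : E -> X) (s : E -> X -> X) :
  cpt n -> cpt b -> cpt (fun p : E * X => s p.1 p.2) ->
  cpt (fun x => iter (n x) (s x) (b x)).
Proof.
move=> tn tb [F tF HF]; have -> : (fun x => iter (n x) (s x) (b x)) =
    (fun x => nat_rect (fun=> X) (b x) (fun _ => s x) (n x)).
  by apply/funext => x; elim: (n x) => //= k ->.
apply: cpt_rec => //.
exists (fun m => F (npair (cfst m) (csnd (csnd m)))).
  by apply: (tc_comp tF); apply: tc_npair; [apply: tc_cfst|apply/tc_csnd/tc_csnd];
    exact: tc_id.
move=> [x [k r]]; rewrite /= /enc /enc_prod /= cfst_npair !csnd_npair.
exact: (HF (x, r)).
Qed.

(** A recursion of length 0 or 1 whose step ignores the value so far. *)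
Lemma cpt_if (b : E -> bool) (f g : E -> X) :
  cpt b -> cpt f -> cpt g -> cpt (fun x => if b x then f x else g x).
Proof.
move=> [B tB HB] [F tF HF] [G tG HG]; exists (fun n =>
    nat_rect (fun=> nat) (G n) (fun k r => F (cfst (npair n (npair k r)))) (B n)).
  by apply: (tc_rec tB tG (h := fun m => F (cfst m)));
    apply: (tc_comp tF); exact/tc_cfst/tc_id.
move=> x; rewrite HB /enc /enc_bool; case: (b x) => /=; last exact: HG.
by rewrite cfst_npair HF.
Qed.

(** The code of a nonempty list is the successor of the pair of its head and tail; in a recursion of
    that length the last step receives this pair as its counter. *)
Lemma cpt_case_seq (s : E -> seq X) (f : E -> Y) (g : E -> X -> seq X -> Y) :
  cpt s -> cpt f -> cpt (fun p : E * (X * seq X) => g p.1 p.2.1 p.2.2) ->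
  cpt (fun x => if s x is a :: l then g x a l else f x).
Proof.
move=> [S tS HS] [F tF HF] [G tG HG]; exists (fun n =>
    nat_rect (fun=> nat) (F n) (fun k r =>
      (fun m => G (npair (cfst m) (cfst (csnd m)))) (npair n (npair k r))) (S n)).
  apply: (tc_rec tS tF (h := fun m => G (npair (cfst m) (cfst (csnd m))))).
  apply: (tc_comp tG).
  by apply: tc_npair; [apply/tc_cfst|apply/tc_cfst/tc_csnd]; exact: tc_id.
move=> x; rewrite HS /enc /enc_seq; case: (s x) => [|a l] /=; first exact: HF.
by rewrite !(cfst_npair, csnd_npair); exact: (HG (x, (a, l))).
Qed.

Lemma cpt_cons (f : E -> X) (g : E -> seq X) :
  cpt f -> cpt g -> cpt (fun x => f x :: g x).
Proof.
move=> [F tF HF] [G tG HG]; exists (fun n => (npair (F n) (G n)).+1).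
  exact/tc_succ/tc_npair.
by move=> x; rewrite HF HG.
Qed.

Lemma cpt_succ (f : E -> nat) : cpt f -> cpt (fun x => (f x).+1).
Proof.
move=> [F tF HF]; exists (fun n => (F n).+1); first exact: tc_succ.
by move=> x; rewrite HF.
Qed.

Lemma cpt_npair (f g : E -> nat) : cpt f -> cpt g -> cpt (fun x => npair (f x) (g x)).
Proof.
move=> [F tF HF] [G tG HG]; exists (fun n => npair (F n) (G n)).
  exact: tc_npair.
by move=> x; rewrite HF HG.
Qed.

Lemma cpt_cfst (f : E -> nat) : cpt f -> cpt (fun x => cfst (f x)).
Proof.
move=> [F tF HF]; exists (fun n => cfst (F n)); first exact: tc_cfst.
by move=> x; rewrite HF.
Qed.

Lemma cpt_csnd (f : E -> nat) : cpt f -> cpt (fun x => csnd (f x)).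
Proof.
move=> [F tF HF]; exists (fun n => csnd (F n)); first exact: tc_csnd.
by move=> x; rewrite HF.
Qed.

End Cpt.

(** Lets the code of a list serve as a computable bound on its length, for instance as fuel for a
    loop over the list. *)
Lemma size_enc (T : Type) {eT : encoding T} (s : seq T) : size s <= enc s.
Proof.
elim: s => //= a s IH; rewrite ltnS; exact: leq_trans IH (leq_npairr _ _).
Qed.

Lemma cpt_pred (E : Type) (eE : encoding E) (f : E -> nat) :
  cpt f -> cpt (fun x => (f x).-1).
Proof.
move=> tf; have -> : (fun x => (f x).-1) =
    (fun x => nat_rect (fun=> nat) 0 (fun k _ => k) (f x)).
  by apply/funext => x; case: (f x).
apply: cpt_rec => //; first exact: cpt_const.
exact/cpt_fst/cpt_snd/cpt_id.
Qed.

Lemma cpt_sub (E : Type) (eE : encoding E) (f g : E -> nat) :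
  cpt f -> cpt g -> cpt (fun x => f x - g x).
Proof.
move=> tf tg; have -> : (fun x => f x - g x) = (fun x => iter (g x) predn (f x)).
  by apply/funext => x; elim: (g x) => [|k /= <-]; rewrite ?subn0 ?subnS.
apply: (cpt_iter tg tf (s := fun=> predn)); apply: cpt_pred; exact/cpt_snd/cpt_id.
Qed.

Lemma cpt_minn (E : Type) (eE : encoding E) (f g : E -> nat) :
  cpt f -> cpt g -> cpt (fun x => minn (f x) (g x)).
Proof.
move=> tf tg; have -> : (fun x => minn (f x) (g x)) = (fun x => f x - (f x - g x)).
  by apply/funext => x; rewrite minnE.
by do 2?apply: cpt_sub.
Qed.

Lemma cpt_eq0 (E : Type) (eE : encoding E) (f : E -> nat) :
  cpt f -> cpt (fun x => f x == 0).
Proof.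
move=> tf; have -> : (fun x => f x == 0) =
    (fun x => nat_rect (fun=> bool) true (fun _ _ => false) (f x)).
  by apply/funext => x; case: (f x).
by apply: cpt_rec => //; exact: cpt_const.
Qed.

Lemma cpt_leq (E : Type) (eE : encoding E) (f g : E -> nat) :
  cpt f -> cpt g -> cpt (fun x => f x <= g x).
Proof. by move=> tf tg; apply: cpt_eq0; exact: cpt_sub. Qed.

Lemma cpt_eqn (E : Type) (eE : encoding E) (f g : E -> nat) :
  cpt f -> cpt g -> cpt (fun x => f x == g x).
Proof.
move=> tf tg; have -> : (fun x => f x == g x) =
    (fun x => if f x <= g x then g x <= f x else false).
  by apply/funext => x; rewrite eqn_leq.
by apply: cpt_if; [exact: cpt_leq|exact: cpt_leq|exact: cpt_const].
Qed.

Lemma cpt_size (E X : Type) (eE : encoding E) (eX : encoding X) (s : E -> seq X) :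
  cpt s -> cpt (fun x => size (s x)).
Proof.
move=> ts; pose step (p : seq X * nat) := if p.1 is _ :: l then (l, p.2.+1) else p.
have stepE n (l : seq X) m : size l <= n -> iter n step (l, m) = ([::], size l + m).
  elim: n l m => [|n IH] [|a l] m //; rewrite iterSr /step /= => le; first exact: IH.
  by rewrite IH // addnS.
have -> : (fun x => size (s x)) = (fun x => (iter (enc (s x)) step (s x, 0)).2).
  by apply/funext => x; rewrite stepE ?addn0 //; exact: size_enc.
apply: cpt_snd; apply: cpt_iter.
- exact: cpt_comp cpt_enc ts.
- by apply: cpt_pair => //; exact: cpt_const.
- apply: (cpt_case_seq (s := fun p => p.2.1) (f := fun p => p.2)
    (g := fun p _ l => (l, p.2.2.+1))).
  + exact/cpt_fst/cpt_snd/cpt_id.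
  + exact/cpt_snd/cpt_id.
  + apply: cpt_pair; first exact/cpt_snd/cpt_snd/cpt_id.
    exact/cpt_succ/cpt_snd/cpt_snd/cpt_fst/cpt_id.
Qed.

Lemma cpt_nth (E X : Type) (eE : encoding E) (eX : encoding X)
    (x0 : X) (s : E -> seq X) (i : E -> nat) :
  cpt s -> cpt i -> cpt (fun x => nth x0 (s x) (i x)).
Proof.
move=> ts ti; pose hd (l : seq X) := if l is a :: _ then a else x0.
pose tl (l : seq X) := if l is _ :: l' then l' else [::].
have -> : (fun x => nth x0 (s x) (i x)) = (fun x => hd (iter (i x) tl (s x))).
  apply/funext => x; elim: (i x) (s x) => [|k IH] [|a l] //; rewrite iterSr /=.
    by rewrite -IH nth_nil.
  exact: IH.
apply: (cpt_case_seq (g := fun _ a _ => a)).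
- apply: cpt_iter => //.
  apply: (cpt_case_seq (s := fun p => p.2) (f := fun=> [::]) (g := fun _ _ l => l)).
  + exact/cpt_snd/cpt_id.
  + exact: cpt_const.
  + exact/cpt_snd/cpt_snd/cpt_id.
- exact: cpt_const.
- exact/cpt_fst/cpt_snd/cpt_id.
Qed.

Lemma cpt_mkseq (E X : Type) (eE : encoding E) (eX : encoding X)
    (f : E -> nat -> X) (n : E -> nat) :
  cpt (fun p : E * nat => f p.1 p.2) -> cpt n -> cpt (fun x => mkseq (f x) (n x)).
Proof.
(* Since [cons] extends at the front, the list is built from its last entry, stage [k] contributing
   the index [n x - k.+1]. *)
move=> tf tn; have -> : (fun x => mkseq (f x) (n x)) = (fun x =>
    nat_rect (fun=> seq X) [::] (fun k l => f x (n x - k.+1) :: l) (n x)).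
  apply/funext => x; suff H k : k <= n x ->
      nat_rect (fun=> seq X) [::] (fun k l => f x (n x - k.+1) :: l) k =
      map (f x) (iota (n x - k) k) by rewrite H // subnn.
  elim: k => //= k IH lt; rewrite IH ?(ltnW lt) //; do 2 f_equal.
  by rewrite subnSK.
apply: (cpt_rec (s := fun x k l => f x (n x - k.+1) :: l)) => //.
  exact: cpt_const.
apply: cpt_cons; last exact/cpt_snd/cpt_snd/cpt_id.
apply: (cpt_comp (g := fun p => f p.1 p.2)
  (f := fun p : E * (nat * seq X) => (p.1, n p.1 - p.2.1.+1))) => //.
apply: cpt_pair; first exact/cpt_fst/cpt_id.
apply: cpt_sub; last exact/cpt_succ/cpt_fst/cpt_snd/cpt_id.
exact/(cpt_comp tn)/cpt_fst/cpt_id.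
Qed.

Lemma cpt_take (E X : Type) (eE : encoding E) (eX : encoding X)
    (x0 : X) (n : E -> nat) (s : E -> seq X) :
  cpt n -> cpt s -> cpt (fun x => take (n x) (s x)).
Proof.
move=> tn ts; have -> : (fun x => take (n x) (s x)) =
    (fun x => mkseq (nth x0 (s x)) (minn (n x) (size (s x)))).
  apply/funext => x; apply: (@eq_from_nth _ x0).
    by rewrite size_take_min size_mkseq.
  move=> i; rewrite size_take_min => lt; rewrite nth_mkseq // nth_take //.
  by apply: leq_trans lt (geq_minl _ _).
apply: cpt_mkseq; last by apply: cpt_minn => //; exact: cpt_size.
apply: cpt_nth; last exact/cpt_snd/cpt_id.
exact/(cpt_comp ts)/cpt_fst/cpt_id.
Qed.

(* The least [r] satisfying [p], or [n] if there is none below [n]. *)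
Definition bsearch (p : pred nat) (n : nat) : nat :=
  iter n (fun r => if p r then r else r.+1) 0.

Lemma bsearchP (p : pred nat) n :
  [/\ bsearch p n <= n, bsearch p n < n -> p (bsearch p n)
    & forall j, j < bsearch p n -> ~~ p j].
Proof.
elim: n => [//|n [le lt H]]; rewrite /bsearch iterS -/(bsearch p n).
case: ifP => pr; first by split=> //; exact: leqW.
have E : bsearch p n = n.
  by apply/eqP; rewrite eqn_leq le leqNgt; apply/negP => /lt; rewrite pr.
split; [by rewrite E|by rewrite E ltnn|].
by move=> j; rewrite ltnS leq_eqVlt => /orP[/eqP ->|/H //]; rewrite pr.
Qed.

Lemma cpt_bsearch (E : Type) (eE : encoding E) (p : E -> pred nat) (n : E -> nat) :
  cpt (fun x : E * nat => p x.1 x.2) -> cpt n -> cpt (fun x => bsearch (p x) (n x)).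
Proof.
move=> tp tn; apply: cpt_iter => //; first exact: cpt_const.
apply: cpt_if => //; first exact/cpt_snd/cpt_id.
exact/cpt_succ/cpt_snd/cpt_id.
Qed.

Ltac cpt_tac := repeat (lazymatch goal with
  | |- cpt (fun x => x) => apply: cpt_id
  | |- cpt fst => exact: (cpt_fst cpt_id)
  | |- cpt snd => exact: (cpt_snd cpt_id)
  | |- cpt size => exact: (cpt_size cpt_id)
  | |- cpt cfst => exact: (cpt_cfst cpt_id)
  | |- cpt csnd => exact: (cpt_csnd cpt_id)
  | |- cpt (fun x => cfst _) => apply: cpt_cfst
  | |- cpt (fun x => csnd _) => apply: cpt_csnd
  | |- cpt (fun x => npair _ _) => apply: cpt_npair
  | |- cpt (fun x => _ == _) => apply: cpt_eqn
  | |- cpt (fun x => _ <= _) => apply: cpt_leq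
  | |- cpt (fun x => _ - _) => apply: cpt_sub
  | |- cpt (fun x => minn _ _) => apply: cpt_minn
  | |- cpt (fun x => _.+1) => apply: cpt_succ
  | |- cpt (fun x => _.-1) => apply: cpt_pred
  | |- cpt (fun x => size _) => apply: cpt_size
  | |- cpt (fun x => _ :: _) => apply: cpt_cons
  | |- cpt (fun x => (_, _)) => apply: cpt_pair
  | |- cpt (fun x => _.1) => apply: cpt_fst
  | |- cpt (fun x => _.2) => apply: cpt_snd
  | _ => first [assumption | apply: cpt_const | apply: cpt_if]
  end).

(** * Kleene's first algebra *)

Definition realizable (A : algebra) (R : A -> A -> Prop) : Prop :=
  exists2 e, computable_elt A e & forall x y, R x y -> e <*> x = Some y.

Lemma realizable_sub (A : algebra) (R S : A -> A -> Prop) :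
  (forall x y, R x y -> S x y) -> realizable S -> realizable R.
Proof. by move=> RS [e ce He]; exists e => // x y /RS/He. Qed.

(* Application is only required to extend the given relations, so that this is
   weaker than the usual combinatory completeness up to Kleene equality. *)
Record pca (A : algebra) : Prop := Pca {
  pair_code_inj : forall x y x' y' : A,
    pair_code x y = pair_code x' y' -> x = x' /\ y = y';
  num01 : num A 0 <> num A 1;
  num0_computable : computable_elt A (num A 0);
  num1_computable : computable_elt A (num A 1);
  realizable_id : realizable (fun x y : A => x = y);
  realizable_const : forall a, computable_elt A a -> realizable (fun _ y => y = a);
  realizable_fst : realizable (fun p x : A => exists y, p = pair_code x y);
  realizable_snd : realizable (fun p y : A => exists x, p = pair_code x y);
  realizable_comp : forall R S : A -> A -> Prop, realizable R -> realizable S ->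
    realizable (fun x z => exists2 y, R x y & S y z);
  realizable_pair : forall R S : A -> A -> Prop, realizable R -> realizable S ->
    realizable (fun x p => exists y z, [/\ R x y, S x z & p = pair_code y z]);
  realizable_app :
    realizable (fun p z : A => exists x y, p = pair_code x y /\ x <*> y = Some z);
  realizable_if : forall R S : A -> A -> Prop, realizable R -> realizable S ->
    realizable (fun p y => exists x,
      p = pair_code (num A 0) x /\ R x y \/ p = pair_code (num A 1) x /\ S x y);
  realizable_curry : forall R : A -> A -> Prop, realizable R ->
    exists2 h : A -> A, realizable (fun x y => y = h x) &
      forall x y z, R (pair_code x y) z -> h x <*> y = Some z
}.

(* A frame [(t, (c, (a, j)))] waits for the value of a subcomputation of an
   index with tag [t]; the frames with tag 8 wait for the second component of
   a pair. *)
Definition frame : Type := nat * (nat * (nat * nat)).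

(* In mode 0 the machine evaluates the index [e] at [n], in mode 1 it returns the
   value [e] to the topmost frame. *)
Definition state : Type := nat * (nat * nat) * seq frame.

Definition estate (e n : nat) (K : seq frame) : state := ((0, (e, n)), K).
Definition rstate (v : nat) (K : seq frame) : state := ((1, (v, 0)), K).

(** The last branch also takes the tags above 7, where [phi] is empty. This is harmless, as the
    machine only has to reproduce the values of [phi]. *)
Definition estep (e n : nat) (K : seq frame) : state :=
  let t := cfst e in let p := csnd e in let c := cfst p in let d := csnd p in
  if t == 0 then rstate 0 K
  else if t == 1 then rstate n.+1 K
  else if t == 2 then rstate (cfst n) K
  else if t == 3 then rstate (csnd n) K
  else if t == 4 then estate c n ((4, (d, (n, 0))) :: K)
  else if t == 5 then estate d n ((5, (c, (0, 0))) :: K)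
  else if t == 6 then
    if csnd n == 0 then estate c (cfst n) K
    else estate (npair 6 (npair c d)) (npair (cfst n) (csnd n).-1)
           ((6, (d, (cfst n, (csnd n).-1))) :: K)
  else estate p (npair n 0) ((7, (p, (n, 0))) :: K).

Definition rstep (v : nat) (f : frame) (K : seq frame) : state :=
  let t := f.1 in let c := f.2.1 in let a := f.2.2.1 in let j := f.2.2.2 in
  if t == 4 then estate c a ((8, (v, (0, 0))) :: K)
  else if t == 8 then rstate (npair c v) K
  else if t == 5 then estate c v K
  else if t == 6 then estate c (npair a (npair j v)) K
  else if v == 0 then rstate j K
  else estate c (npair a j.+1) ((7, (c, (a, j.+1))) :: K).

Definition step (s : state) : state :=
  if s.1.1 == 0 then estep s.1.2.1 s.1.2.2 s.2
  else if s.2 is f :: K then rstep s.1.2.1 f K else s.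

Definition reach (s s' : state) := exists t, iter t step s = s'.

Lemma reach_refl s : reach s s.
Proof. by exists 0. Qed.

Lemma reach_trans s2 s1 s3 : reach s1 s2 -> reach s2 s3 -> reach s1 s3.
Proof. by move=> [t <-] [t' <-]; exists (t' + t); rewrite iterD. Qed.

Lemma reach_step s s' : reach (step s) s' -> reach s s'.
Proof. by move=> [t <-]; exists t.+1; rewrite iterSr. Qed.

(** The stack is arbitrary because the induction hypotheses are applied to subcomputations, which
    run on top of the frames pushed for them. *)
Lemma phi_reach e n m : phi e n m -> forall K, reach (estate e n K) (rstate m K).
Proof.
elim=> {e n m} [p n|p n|p a b|p a b|c d n a b _ IHa _ IHb
  |c d n a b _ IHa _ IHb|c d a b _ IHb|c d a k r b _ IHr _ IHb
  |c a k v Hv IHv Hk IHk] K; apply: reach_step;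
  rewrite /step /= /estep !(cfst_npair, csnd_npair) /=.
- exact: reach_refl.
- exact: reach_refl.
- exact: reach_refl.
- exact: reach_refl.
- apply: reach_trans (IHa _) _; apply: reach_step.
  apply: reach_trans (IHb _) _; apply: reach_step; exact: reach_refl.
- by apply: reach_trans (IHa _) _; apply: reach_step; exact: IHb.
- exact: IHb.
- by apply: reach_trans (IHr _) _; apply: reach_step; exact: IHb.
(* Loop invariant of the search: as long as the values are positive, the machine moves on to the
   next candidate. *)
- suff H i : i <= k ->
      reach (estate c (npair a 0) ((7, (c, (a, 0))) :: K))
            (estate c (npair a i) ((7, (c, (a, i))) :: K)).
    apply: reach_trans (H k (leqnn k)) _; apply: reach_trans (IHk _) _.
    apply: reach_step; exact: reach_refl.
  elim: i => [|i IH] lt; first exact: reach_refl.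
  apply: reach_trans (IH (ltnW lt)) _; apply: reach_trans (IHv i lt _) _.
  apply: reach_step; exact: reach_refl.
Qed.

Lemma cpt_estep (E : Type) (eE : encoding E) (e n : E -> nat) (K : E -> seq frame) :
  cpt e -> cpt n -> cpt K -> cpt (fun x => estep (e x) (n x) (K x)).
Proof. by move=> te tn tK; rewrite /estep /estate /rstate; cpt_tac. Qed.

Lemma cpt_rstep (E : Type) (eE : encoding E) (v : E -> nat) (f : E -> frame)
    (K : E -> seq frame) :
  cpt v -> cpt f -> cpt K -> cpt (fun x => rstep (v x) (f x) (K x)).
Proof. by move=> tv tf tK; rewrite /rstep /estate /rstate; cpt_tac. Qed.

Lemma cpt_step : cpt step.
Proof.
rewrite /step; apply: cpt_if; first by cpt_tac.
  by apply: cpt_estep; cpt_tac.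
apply: (cpt_case_seq (s := fun s : state => s.2) (f := fun s => s)
  (g := fun s f K => rstep s.1.2.1 f K)); try by cpt_tac.
by apply: cpt_rstep; cpt_tac.
Qed.

(** Minimization finds the first time at which the machine returns a value to the empty stack, and
    the value is then read off that state. *)
Lemma phi_universal : exists u, forall e n m, phi e n m -> phi u (npair e n) m.
Proof.
pose run (p : nat * nat) : state :=
  iter p.2 step (estate (cfst p.1) (csnd p.1) [::]).
have trun : cpt run.
  apply: (cpt_iter (s := fun=> step)); try by cpt_tac.
    by rewrite /estate; cpt_tac.
  by apply: (cpt_comp cpt_step); cpt_tac.
pose test (p : nat * nat) : nat :=
  if (run p).1.1 == 0 then 1 else if size (run p).2 == 0 then 0 else 1.
have [T [c Hc] HT] : cpt test.
  by rewrite /test; do ?apply: cpt_if; cpt_tac; apply: cpt_size; cpt_tac.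
have [V [d Hd] HV] : cpt (fun p => (run p).1.2.1) by cpt_tac.
exists (npair 5 (npair d (npair 4 (npair idx_id (npair 7 c))))) => e n m.
move=> /phi_reach/(_ [::]) [t Ht].
have halts : test (npair e n, t) = 0.
  by rewrite /test /run /= cfst_npair csnd_npair Ht.
have ex : exists k, test (npair e n, k) == 0 by exists t; rewrite halts.
case: (ex_minnP ex) => k /eqP k0 kmin.
have le : k <= t by apply: kmin; rewrite halts.
(* A halted state is fixed by [step], so the state at the least halting time [k] is the one at time
   [t]. *)
have {}Ht : run (npair e n, k) = rstate m [::].
  rewrite -Ht -(subnK le) iterD /run /= cfst_npair csnd_npair.
  move: k0; rewrite /test /run /= cfst_npair csnd_npair.
  case: (iter k step _) => [[md vn] [|f K]] /=; case: eqP => // /eqP md0 _.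
  by elim: (t - k) => //= j <-; rewrite /step /= (negPf md0).
apply: (@phi_comp _ _ _ (npair (npair e n) k)).
  apply: phi_pair; first exact: phi_id.
  apply: (@phi_mu _ _ _ (fun j => (test (npair e n, j)).-1)).
    move=> j lt; rewrite prednK; last first.
      by rewrite lt0n; apply/negP => /kmin; rewrite leqNgt lt.
    by rewrite -[test _](HT (npair e n, j)).
  by rewrite -k0 -[test _](HT (npair e n, k)).
have -> : m = (run (npair e n, k)).1.2.1 by rewrite Ht.
by rewrite -[_.1](HV (npair e n, k)).
Qed.

Lemma kleene_first_app (e n m : kleene_first) : e <*> n = Some m <-> phi e n m.
Proof. apply: opt_ofP => a b; exact: phi_functional. Qed.

Lemma realizable_phi (R : kleene_first -> kleene_first -> Prop) :
  realizable R <-> exists e, forall x y, R x y -> phi e x y.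
Proof.
split=> [[e _ He]|[e He]]; exists e => // x y /He; by rewrite kleene_first_app.
Qed.

(** For currying, an index of a constant has to be computed from that constant. *)
Lemma cpt_idx_const : cpt idx_const.
Proof.
have -> : idx_const = fun m =>
    nat_rect (fun=> nat) (npair 0 0) (fun _ r => npair 5 (npair (npair 1 0) r)) m.
  by apply/funext; elim=> //= m ->.
apply: (cpt_rec (s := fun _ _ r => npair 5 (npair (npair 1 0) r))); cpt_tac.
Qed.

Lemma tc_cpt (f : nat -> nat) : cpt f -> total_computable f.
Proof. by move=> [F tF HF]; have -> : f = F by apply/funext => n; rewrite -[f n]HF. Qed.

Lemma pca_kleene_first : pca kleene_first.
Proof.
split=> //=.
- exact: npair_inj.
- by rewrite realizable_phi; exists idx_id => x y <-; exact: phi_id.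
- move=> a _; rewrite realizable_phi; exists (idx_const a) => x y ->; exact: phi_const.
- by rewrite realizable_phi; exists (npair 2 0) => p x [y ->]; constructor.
- by rewrite realizable_phi; exists (npair 3 0) => p y [x ->]; constructor.
- move=> R S; rewrite !realizable_phi => -[d Hd] [c Hc].
  by exists (npair 5 (npair c d)) => x z [y /Hd ? /Hc]; exact: phi_comp.
- move=> R S; rewrite !realizable_phi => -[c Hc] [d Hd].
  by exists (npair 4 (npair c d)) => x p [y [z [/Hc ? /Hd ? ->]]]; exact: phi_pair.
- rewrite realizable_phi; have [u Hu] := phi_universal.
  by exists u => p z [x [y [-> /kleene_first_app]]]; exact: Hu.
- move=> R S; rewrite !realizable_phi => -[c Hc] [d Hd]; have [u Hu] := phi_universal.
  (* The branch that is not selected may diverge, so a total function selects the index only, and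
     the universal index then runs it. *)
  have [s Hs] : total_computable (fun p =>
      npair (if cfst p == 0 then c else d) (csnd p)).
    by apply: tc_cpt; cpt_tac.
  exists (npair 5 (npair u s)) => p y [x [] [-> H]];
    apply: phi_comp (Hs _) (Hu _ _ _ _);
    rewrite !(cfst_npair, csnd_npair) /=; [exact: Hc|exact: Hd].
- move=> R; rewrite realizable_phi => -[c Hc].
  (* The s-m-n construction: pair the constant [x] with the argument, then run [c]. *)
  pose h x := npair 5 (npair c (npair 4 (npair (idx_const x) idx_id))).
  exists h.
    rewrite realizable_phi; have [s Hs] : total_computable h.
      apply: tc_cpt; rewrite /h; cpt_tac; exact: cpt_idx_const.
    by exists s => x y ->.
  move=> x y z /Hc H; rewrite kleene_first_app; apply: phi_comp H.
  apply: phi_pair; [exact: phi_const|exact: phi_id].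
Qed.

(** * Baire space *)

Lemma eq_in_mkseq (T : Type) (f g : nat -> T) n :
  (forall i, i < n -> f i = g i) -> mkseq f n = mkseq g n.
Proof. by move=> fg; apply/eq_in_map => i; rewrite mem_iota => /fg. Qed.

Lemma take_mkseq (T : Type) (f : nat -> T) k n :
  k <= n -> take k (mkseq f n) = mkseq f k.
Proof. by move=> le; rewrite /mkseq -map_take take_iota (minn_idPl le). Qed.

Lemma enc_seq_inj (s t : seq nat) : enc s = enc t -> s = t.
Proof.
elim: s t => [|a s IH] [|b t] //= -[/npair_inj[ab /IH ->]].
by congr (_ :: _); exact: ab.
Qed.

Lemma enc_seq_surj (m : nat) : exists s : seq nat, enc s = m.
Proof.
elim/ltn_ind: m => -[|m] IH; first by exists [::].
have [|s Es] := IH (csnd m); first by rewrite ltnS -{2}(npairK m) leq_npairr.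
exists (cfst m :: s); rewrite -[in RHS](npairK m) -Es.
by [].
Qed.

Definition dec (m : nat) : seq nat := sval (cid (enc_seq_surj m)).

Lemma decK m : enc (dec m) = m.
Proof. by rewrite /dec; case: cid. Qed.

Lemma encK s : dec (enc s) = s.
Proof. exact/enc_seq_inj/decK. Qed.

(** Although [dec] is chosen classically, on codes it amounts to the identity. *)
Lemma cpt_dec : cpt dec.
Proof. by exists id; [exact: tc_id|move=> m; rewrite decK]. Qed.

(* [known es i xs] is [0] or one more than the [i]-th value of the function with
   index [e] at [x], as far as it is determined by the prefixes [es] of [e] and
   [xs] of [x]. *)
Definition known (es : seq nat) (i : nat) (xs : seq nat) : nat :=
  nth 0 es (enc (i :: take (bsearch (fun k =>
    if size es <= enc (i :: take k xs) then true
    else 0 < nth 0 es (enc (i :: take k xs))) (size xs)) xs)).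

Definition app_seq (es xs : seq nat) : seq nat :=
  mkseq (fun i => (known es i xs).-1)
        (bsearch (fun i => known es i xs == 0) (size xs)).

Lemma cpt_known (E : Type) (eE : encoding E) (es xs : E -> seq nat) (i : E -> nat) :
  cpt es -> cpt i -> cpt xs -> cpt (fun x => known (es x) (i x) (xs x)).
Proof.
move=> tes ti txs; apply: cpt_nth => //; apply: (cpt_comp cpt_enc).
apply: cpt_cons => //; apply: (cpt_take 0) => //.
apply: cpt_bsearch; last exact: cpt_size.
have tc : cpt (fun p : E * nat => enc (i p.1 :: take p.2 (xs p.1))).
  apply: (cpt_comp cpt_enc); apply: cpt_cons.
    by apply: (cpt_comp ti); cpt_tac.
  by apply: (cpt_take 0); [cpt_tac|apply: (cpt_comp txs); cpt_tac].
have tes' : cpt (fun p : E * nat => es p.1) by apply: (cpt_comp tes); cpt_tac.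
by cpt_tac; apply: cpt_nth.
Qed.

Lemma cpt_app_seq (E : Type) (eE : encoding E) (es xs : E -> seq nat) :
  cpt es -> cpt xs -> cpt (fun x => app_seq (es x) (xs x)).
Proof.
move=> tes txs.
have tk : cpt (fun p : E * nat => known (es p.1) p.2 (xs p.1)).
  by apply: cpt_known; [apply: (cpt_comp tes)| |apply: (cpt_comp txs)]; cpt_tac.
apply: cpt_mkseq; first exact: cpt_pred.
by apply: cpt_bsearch; [exact: cpt_eq0|exact: cpt_size].
Qed.

Lemma known_sound e x z m i : baire_phi e x z ->
  known (mkseq e m) i (mkseq x m) = 0 \/ known (mkseq e m) i (mkseq x m) = (z i).+1.
Proof.
move=> H; have [K [HK LK]] := H i.
rewrite /known !size_mkseq; set p := (fun k => _).
have [rm _ Hr] := bsearchP p m; set r := bsearch p m in rm Hr *.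
rewrite take_mkseq //; case: (ltnP (enc (i :: mkseq x r)) m) => [lt|le]; last first.
  (* Outside the prefix of [e], [nth] defaults to 0, which reads as unknown. *)
  by left; rewrite nth_default ?size_mkseq.
rewrite nth_mkseq //; case: (ltngtP r K) => [/LK ->||->]; [by left| |by right].
(* A search that went past [K] would have rejected it, but at [K] the code is either out of range or
   a position where [e] is positive, and both stop the search. *)
move=> ltK; have := Hr _ ltK; rewrite /p take_mkseq ?(leq_trans (ltnW ltK)) //.
by case: (leqP m) => // ltm; rewrite nth_mkseq // [e _]HK.
Qed.

Lemma bigmax_le (f : nat -> nat) (n : nat) :
  exists M, forall i, i < n -> f i <= M.
Proof.
exists (\max_(i < n) f i) => i lt; exact: (leq_bigmax (Ordinal lt)).
Qed.

Lemma known_complete e x z i : baire_phi e x z ->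
  exists m0, forall m, m0 <= m -> known (mkseq e m) i (mkseq x m) = (z i).+1.
Proof.
move=> H; have [K [HK LK]] := H i.
(* [M] bounds the codes of all prefixes of length at most [K]; once [m] exceeds it, every value of
   [e] consulted by the search is available. *)
have [M HM] := bigmax_le (fun j => enc (i :: mkseq x j)) K.+1.
exists (maxn K M.+1) => m; rewrite geq_max => /andP[Km Mm].
have small j : j <= K -> enc (i :: mkseq x j) < m.
  by move=> le; apply: leq_ltn_trans (HM j le) Mm.
rewrite /known !size_mkseq; set p := (fun k => _).
have pj j : j <= K -> p j = (0 < e (enc (i :: mkseq x j))).
  move=> le; rewrite /p take_mkseq ?(leq_trans le) // leqNgt small //=.
  by rewrite nth_mkseq // small.
have [rm Hr1 Hr] := bsearchP p m; set r := bsearch p m in rm Hr1 Hr *.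
have E : r = K.
  case: (ltngtP r K) => // lt.
    have := Hr1 (leq_trans lt Km); rewrite pj ?(ltnW lt) //.
    by rewrite [e _]LK.
  by have := Hr _ lt; rewrite pj // [e _]HK.
by rewrite E take_mkseq // nth_mkseq ?small.
Qed.

(* A function on prefixes tracks [x |-> y] if it sends prefixes of [x] to prefixes
   of [y] whose length tends to infinity. *)
Definition tracks (T : seq nat -> seq nat) (x y : nat -> nat) : Prop :=
  (forall m, exists l, T (mkseq x m) = mkseq y l) /\
  forall L, exists m0, forall m, m0 <= m -> L <= size (T (mkseq x m)).

Lemma bounded_uniform (P : nat -> nat -> Prop) :
  (forall i, exists m0, forall m, m0 <= m -> P i m) ->
  forall L, exists m0, forall m, m0 <= m -> forall i, i < L -> P i m.
Proof.
move=> H L; have [M HM] := bigmax_le (fun i => sval (cid (H i))) L.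
exists M => m le i lt; apply: (svalP (cid (H i))); exact: leq_trans (HM i lt) le.
Qed.

(** The output stops at the first unknown value, which makes it a prefix of [z]. Its length is also
    capped by that of the input, hence the maximum with [L]. *)
Lemma app_seq_tracks e x z : baire_phi e x z ->
  (forall m, exists l, app_seq (mkseq e m) (mkseq x m) = mkseq z l) /\
  forall L, exists m0, forall m, m0 <= m ->
    L <= size (app_seq (mkseq e m) (mkseq x m)).
Proof.
move=> H; split=> [m|L].
  rewrite /app_seq; set p := (fun i => _ == 0); rewrite size_mkseq.
  exists (bsearch p m); apply: eq_in_mkseq => i lt.
  have [_ _ /(_ i lt)] := bsearchP p m; rewrite /p.
  by case: (known_sound m i H) => ->.
have [m0 Hm0] := bounded_uniform (fun i => known_complete i H) L.
exists (maxn m0 L) => m; rewrite geq_max => /andP[le0 leL].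
rewrite /app_seq; set p := (fun i => _ == 0); rewrite !size_mkseq.
have [rm Hr _] := bsearchP p m; rewrite leqNgt; apply/negP => lt.
by have := Hr (leq_trans lt leL); rewrite /p Hm0.
Qed.

(** The answer format of [baire_phi]: 0 asks for a longer prefix, a positive number is one more than
    the value. *)
Definition lookup (r : seq nat) (n : nat) : nat :=
  if n < size r then (nth 0 r n).+1 else 0.

Lemma cpt_lookup (E : Type) (eE : encoding E) (r : E -> seq nat) (n : E -> nat) :
  cpt r -> cpt n -> cpt (fun x => lookup (r x) (n x)).
Proof. by move=> tr tn; rewrite /lookup; cpt_tac; exact: cpt_nth. Qed.

(** Every entry of [a] consulted is 0 or correct, so the first nonzero one gives the value. The
    input [p] of [T] may differ from [y], as in currying, where [p] is a pair with second component
    [y]. *)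
Lemma tracks_baire_phi T p z a y : tracks T p z ->
  (forall n k, a (enc (n :: mkseq y k)) = lookup (T (mkseq p k)) n) ->
  baire_phi a y z.
Proof.
move=> [T1 T2] Ha n.
have sound k : a (enc (n :: mkseq y k)) = 0 \/ a (enc (n :: mkseq y k)) = (z n).+1.
  rewrite Ha /lookup; have [l ->] := T1 k; rewrite size_mkseq.
  by case: ltnP => lt; [right; rewrite nth_mkseq|left].
have ex : exists k, a (enc (n :: mkseq y k)) != 0.
  have [m0 /(_ m0 (leqnn _)) lt] := T2 n.+1.
  by exists m0; rewrite Ha /lookup lt.
case: (ex_minnP ex) => k nz kmin; exists k; split.
  by case: (sound k) => // E; rewrite E in nz.
move=> j lt; case: (sound j) => // E.
have : k <= j by apply: kmin; rewrite E.
by rewrite leqNgt lt.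
Qed.

(** Kleene's second algebra ([b] false) and the Kleene-Vesley algebra ([b] true) are treated at
    once; computability claims below are guarded by [b]. *)
Definition baire_algebra (b : bool) : algebra :=
  Algebra baire_app [set x | b -> total_computable x]
    baire_pair (fun k => fun=> k).

Lemma baire_secondE : kleene_second = baire_algebra false.
Proof. by rewrite /kleene_second /baire_algebra; congr Algebra; apply/seteqP. Qed.

Lemma baire_vesleyE : kleene_vesley = baire_algebra true.
Proof.
rewrite /kleene_vesley /baire_algebra; congr Algebra.
by apply/seteqP; split=> x /=; [move=> H _|apply].
Qed.

Lemma cpt_tc (f : nat -> nat) : total_computable f -> cpt f.
Proof. by move=> tf; exists f. Qed.

Definition zip_npair (s t : seq nat) : seq nat :=
  mkseq (fun i => npair (nth 0 s i) (nth 0 t i)) (minn (size s) (size t)).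

Definition map_seq (f : nat -> nat) (s : seq nat) : seq nat :=
  mkseq (fun i => f (nth 0 s i)) (size s).

Lemma zip_npair_mkseq x y m n :
  zip_npair (mkseq x m) (mkseq y n) = mkseq (baire_pair x y) (minn m n).
Proof.
rewrite /zip_npair !size_mkseq; apply: eq_in_mkseq => i.
by rewrite leq_min => /andP[lm ln]; rewrite !nth_mkseq.
Qed.

Lemma map_seq_mkseq f x m : map_seq f (mkseq x m) = mkseq (f \o x) m.
Proof.
by rewrite /map_seq size_mkseq; apply: eq_in_mkseq => i lt; rewrite nth_mkseq.
Qed.

Lemma cpt_zip_npair (E : Type) (eE : encoding E) (s t : E -> seq nat) :
  cpt s -> cpt t -> cpt (fun x => zip_npair (s x) (t x)).
Proof.
move=> ts tt; apply: cpt_mkseq; last by cpt_tac.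
by cpt_tac; (apply: cpt_nth; [apply: cpt_comp; [eassumption|]|]); cpt_tac.
Qed.

Lemma cpt_map_seq (E : Type) (eE : encoding E) (f : nat -> nat) (s : E -> seq nat) :
  cpt f -> cpt s -> cpt (fun x => map_seq f (s x)).
Proof.
move=> tf ts; apply: cpt_mkseq; last by cpt_tac.
apply: (cpt_comp tf); apply: cpt_nth; last by cpt_tac.
by apply: (cpt_comp ts); cpt_tac.
Qed.

Lemma cfst_baire_pair x y : cfst \o baire_pair x y = x.
Proof. by apply/funext => n; rewrite /= cfst_npair. Qed.

Lemma csnd_baire_pair x y : csnd \o baire_pair x y = y.
Proof. by apply/funext => n; rewrite /= csnd_npair. Qed.

Section Tracked.
Variable b : bool.
Let A := baire_algebra b.
Implicit Types R S : A -> A -> Prop.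

Lemma baire_appP (x y z : A) : x <*> y = Some z <-> baire_phi x y z.
Proof. apply: opt_ofP => ? ?; exact: baire_phi_functional. Qed.

Definition tracked (R : (nat -> nat) -> (nat -> nat) -> Prop) : Prop :=
  exists2 T, (b -> cpt T) & forall x y, R x y -> tracks T x y.

(** From an index [e], a prefix of [e] as long as the input is applied to the input. Conversely, an
    index tabulates the outputs of [T] on all coded prefixes. *)
Lemma realizable_tracked R : realizable R <-> tracked R.
Proof.
split=> [[e te He]|[T tT HT]].
  exists (fun xs => app_seq (mkseq e (size xs)) xs).
    move=> /te /cpt_tc te'; apply: cpt_app_seq; last exact: cpt_id.
    apply: cpt_mkseq; last by apply: cpt_size; exact: cpt_id.
    by apply: (cpt_comp te'); cpt_tac.
  move=> x y /He/baire_appP/app_seq_tracks[T1 T2]; split=> [m|L].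
    by rewrite size_mkseq.
  by have [m0 Hm0] := T2 L; exists m0 => m /Hm0; rewrite size_mkseq.
exists (fun c => if dec c is n :: xs then lookup (T xs) n else 0).
  move=> /tT tT'; apply: tc_cpt.
  apply: (cpt_case_seq (g := fun _ n xs => lookup (T xs) n)).
  - exact: cpt_dec.
  - exact: cpt_const.
  - by apply: cpt_lookup; [apply: (cpt_comp tT')|]; cpt_tac.
move=> x y /HT tr; apply/baire_appP; apply: (tracks_baire_phi tr) => n k.
by rewrite encK.
Qed.

Lemma tracks_comp T T' x y z :
  tracks T x y -> tracks T' y z -> tracks (T' \o T) x z.
Proof.
move=> [T1 T2] [T1' T2']; split=> [m|L] /=.
  by have [l ->] := T1 m; exact: T1'.
have [m' H'] := T2' L; have [m0 H0] := T2 m'; exists m0 => m /H0.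
by have [l ->] := T1 m; rewrite size_mkseq => /H'.
Qed.

Lemma tracks_pair T T' x y z : tracks T x y -> tracks T' x z ->
  tracks (fun s => zip_npair (T s) (T' s)) x (baire_pair y z).
Proof.
move=> [T1 T2] [T1' T2']; split=> [m|L].
  have [l ->] := T1 m; have [l' ->] := T1' m; exists (minn l l').
  exact: zip_npair_mkseq.
have [m' H'] := T2' L; have [m0 H0] := T2 L; exists (maxn m0 m') => m.
rewrite geq_max => /andP[/H0 le0 /H' le']; rewrite size_mkseq.
by rewrite leq_min le0.
Qed.

Lemma tracks_map f x : tracks (map_seq f) x (f \o x).
Proof.
split=> [m|L]; first by exists m; rewrite map_seq_mkseq.
by exists L => m; rewrite map_seq_mkseq size_mkseq.
Qed.

Lemma tracks_fst x y : tracks (map_seq cfst) (baire_pair x y) x.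
Proof. by rewrite -{2}(cfst_baire_pair x y); exact: tracks_map. Qed.

Lemma tracks_snd x y : tracks (map_seq csnd) (baire_pair x y) y.
Proof. by rewrite -{2}(csnd_baire_pair x y); exact: tracks_map. Qed.

Lemma tracked_if R S : tracked R -> tracked S ->
  tracked (fun p y => exists x, p = pair_code (num A 0) x /\ R x y \/
                                p = pair_code (num A 1) x /\ S x y).
Proof.
move=> [T tT HT] [T' tT' HT'].
(* The tags are constant functions, so the first entry decides the branch; before it is available
   the output is the empty prefix. *)
exists (fun s => if size s == 0 then [::] else
    if cfst (nth 0 s 0) == 0 then T (map_seq csnd s) else T' (map_seq csnd s)).
  move=> hb; have tm : cpt (map_seq csnd) by apply: cpt_map_seq; cpt_tac.
  by cpt_tac; [apply: cpt_nth; cpt_tac|exact: (cpt_comp (tT hb) tm)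
    |exact: (cpt_comp (tT' hb) tm)].
have main a x y : tracks (if a == 0 then T else T') x y ->
    tracks (fun s => if size s == 0 then [::] else
      if cfst (nth 0 s 0) == 0 then T (map_seq csnd s) else T' (map_seq csnd s))
    (baire_pair (fun=> a) x) y.
  move=> /(tracks_comp (tracks_snd (fun=> a) x)) [T1 T2].
  split=> [[|m]|L]; first by exists 0.
    by have [l El] := T1 m.+1; exists l; rewrite -El /= cfst_npair; case: eqP.
  have [m0 Hm0] := T2 L; exists m0.+1 => -[|m] //= lt.
  by have := Hm0 m.+1 (ltnW lt); rewrite /= cfst_npair; case: eqP.
by move=> _ y [x [] [-> H]]; apply: main; [exact: HT|exact: HT'].
Qed.

(** The entry of [h x] at the code [m] of [n :: ys] looks up [n] in [T] run on [x] zipped with [ys].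
    As [ys] is shorter than [m], the first [m] entries of [x] suffice, so that [h] itself is
    tracked. *)
Lemma tracked_curry R : tracked R ->
  exists2 h : A -> A, tracked (fun x y => y = h x) &
    forall x y z, R (pair_code x y) z -> h x <*> y = Some z.
Proof.
move=> [T tT HT].
pose g xs m := if dec m is n :: ys then lookup (T (zip_npair xs ys)) n else 0.
have size_dec m n ys : dec m = n :: ys -> size ys < m.
  by move=> E; rewrite -(decK m) E; exact: size_enc (n :: ys).
have zipE x ys m k : size ys <= m <= k ->
    zip_npair (mkseq x k) ys = zip_npair (mkseq x m) ys.
  move=> /andP[sm mk]; rewrite /zip_npair !size_mkseq.
  rewrite (minn_idPr sm) (minn_idPr (leq_trans sm mk)).
  apply: eq_in_mkseq => i lt; rewrite !nth_mkseq //.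
    exact: leq_trans lt sm.
  exact: leq_trans lt (leq_trans sm mk).
exists (fun x m => g (mkseq x m) m).
  (* Here [g] gets the whole prefix [xs] instead of its first [m] entries; by [zipE] the result is
     the same. *)
  exists (fun xs => mkseq (g xs) (size xs)).
    move=> hb; apply: cpt_mkseq; last by cpt_tac.
    apply: (cpt_case_seq (s := fun p : seq nat * nat => dec p.2)
      (g := fun p n ys => lookup (T (zip_npair p.1 ys)) n)).
    - by apply: (cpt_comp cpt_dec); cpt_tac.
    - exact: cpt_const.
    - apply: cpt_lookup; last by cpt_tac.
      by apply: (cpt_comp (tT hb)); apply: cpt_zip_npair; cpt_tac.
  move=> x _ ->; split=> [k|L]; last by exists L => m; rewrite !size_mkseq.
  exists k; rewrite size_mkseq; apply: eq_in_mkseq => m lt.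
  rewrite /g; case E : (dec m) => [|n ys] //.
  by rewrite (zipE _ _ m) // (ltnW (size_dec _ _ _ E)) ltnW.
move=> x y z /HT tr; apply/baire_appP; apply: (tracks_baire_phi tr) => n k.
rewrite /g encK zip_npair_mkseq; congr (lookup (T (mkseq _ _)) _).
apply/minn_idPr; apply: leq_trans (size_enc (n :: mkseq y k)).
by rewrite [size _]/= size_mkseq leqnSn.
Qed.

Lemma pca_baire : pca A.
Proof.
have tc_num k : total_computable (fun=> k) := tc_const k.
split=> //=.
- move=> x y x' y' E; split; first by rewrite -(cfst_baire_pair x y) E cfst_baire_pair.
  by rewrite -(csnd_baire_pair x y) E csnd_baire_pair.
- by move=> /(f_equal (fun f => f 0)).
- apply/realizable_tracked; exists id; first by move=> _; exact: cpt_id.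
  move=> x _ <-; split=> [m|L]; first by exists m.
  by exists L => m; rewrite size_mkseq.
- move=> a ta; apply/realizable_tracked; exists (fun s => mkseq a (size s)).
    move=> /ta/cpt_tc ta'; apply: cpt_mkseq; last by cpt_tac.
    by apply: (cpt_comp ta'); cpt_tac.
  move=> x _ ->; split=> [m|L]; first by exists m; rewrite size_mkseq.
  by exists L => m; rewrite !size_mkseq.
- apply/realizable_tracked; exists (map_seq cfst).
    by move=> _; apply: cpt_map_seq; cpt_tac.
  by move=> _ x [y ->]; exact: tracks_fst.
- apply/realizable_tracked; exists (map_seq csnd).
    by move=> _; apply: cpt_map_seq; cpt_tac.
  by move=> _ y [x ->]; exact: tracks_snd.
- move=> R S /realizable_tracked[T tT HT] /realizable_tracked[T' tT' HT'].
  apply/realizable_tracked; exists (T' \o T).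
    by move=> hb; apply: cpt_comp; auto.
  by move=> x z [y /HT Rxy /HT']; exact: tracks_comp.
- move=> R S /realizable_tracked[T tT HT] /realizable_tracked[T' tT' HT'].
  apply/realizable_tracked; exists (fun s => zip_npair (T s) (T' s)).
    by move=> hb; apply: cpt_zip_npair; auto.
  by move=> x _ [y [z [/HT Rxy /HT' Rxz ->]]]; exact: tracks_pair.
- apply/realizable_tracked; exists (fun s => app_seq (map_seq cfst s) (map_seq csnd s)).
    by move=> _; apply: cpt_app_seq; apply: cpt_map_seq; cpt_tac.
  move=> _ z [x [y [-> /baire_appP/app_seq_tracks[T1 T2]]]]; split=> [m|L].
    by rewrite !map_seq_mkseq cfst_baire_pair csnd_baire_pair.
  have [m0 H0] := T2 L; exists m0 => m.
  by rewrite !map_seq_mkseq cfst_baire_pair csnd_baire_pair => /H0.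
- by move=> R S /realizable_tracked tR /realizable_tracked tS;
    apply/realizable_tracked; exact: tracked_if.
- move=> R /realizable_tracked/tracked_curry[h th Hh].
  by exists h => //; apply/realizable_tracked.
Qed.

End Tracked.

(** * Programs over a combinatory structure *)

(** Lambda terms with de Bruijn indices. Constants are computable elements, so that every term
    compiles to a computable index. *)
Inductive term (A : algebra) :=
| Var of nat
| Cst of {a : A | computable_elt A a}
| Ap of term A & term A
| Pr of term A & term A
| Fst of term A
| Snd of term A
| If of term A & term A & term A
| La of term A.

Arguments Var {A} n.

Section Terms.
Variable A : algebra.
Hypothesis pcaA : pca A.
Implicit Types (x y z v w : A) (t : term A) (r : seq A).

Definition index : Type := {e : A | computable_elt A e}.

Definition graph (c : index) x y : Prop := sval c <*> x = Some y.

Lemma realizable_graph c : realizable (graph c).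
Proof. by exists (sval c); [exact: svalP|]. Qed.

Definition pick_index (R : A -> A -> Prop) (h : realizable R) : index :=
  let s := cid2 h in exist _ (s2val s) (s2valP s).

Lemma pick_indexP (R : A -> A -> Prop) (h : realizable R) x y :
  R x y -> graph (pick_index h) x y.
Proof. exact: (s2valP' (cid2 h)). Qed.

(** The newest variable is the second component, matching the order of environment and argument in
    [realizable_curry]. *)
Definition env_code : seq A -> A := foldr (fun z c => pair_code c z) (num A 0).

Lemma realizable_var n :
  realizable (fun c x => exists2 r, c = env_code r & onth r n = Some x).
Proof.
elim: n => [|n IH].
  apply: realizable_sub (realizable_snd pcaA) => _ x [[|y r] //= -> [->]].
  by exists (env_code r).
apply: realizable_sub (realizable_comp pcaA (realizable_fst pcaA) IH).
move=> _ x [[|y r] //= -> E].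
by exists (env_code r); [exists y|exists r].
Qed.

Definition curry_spec (c : index) :=
  cid2 (realizable_curry pcaA (realizable_graph c)).

Fixpoint compile t : index :=
  match t with
  | Var n => pick_index (realizable_var n)
  | Cst a => pick_index (realizable_const pcaA (svalP a))
  | Ap s t => pick_index (realizable_comp pcaA
      (realizable_pair pcaA (realizable_graph (compile s))
        (realizable_graph (compile t)))
      (realizable_app pcaA))
  | Pr s t => pick_index (realizable_pair pcaA
      (realizable_graph (compile s)) (realizable_graph (compile t)))
  | Fst t => pick_index (realizable_comp pcaA (realizable_graph (compile t))
      (realizable_fst pcaA))
  | Snd t => pick_index (realizable_comp pcaA (realizable_graph (compile t))
      (realizable_snd pcaA))
  | If s t u => pick_index (realizable_comp pcaA
      (realizable_pair pcaA (realizable_graph (compile s)) (realizable_id pcaA))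
      (realizable_if pcaA (realizable_graph (compile t))
        (realizable_graph (compile u))))
  | La t => pick_index (s2valP (curry_spec (compile t)))
  end.

(** A closure in the sense of functional programming: the element denoted by the abstraction of [t]
    in the environment [r]. It is unrelated to [closure_mmap]. *)
Definition closure t r : A := s2val (curry_spec (compile t)) (env_code r).

Definition ofst v : option A := opt_of (fun x => exists y, v = pair_code x y).
Definition osnd v : option A := opt_of (fun y => exists x, v = pair_code x y).

Lemma ofstP v x : ofst v = Some x <-> exists y, v = pair_code x y.
Proof. by apply: opt_ofP => a b [c ->] [d] /(pair_code_inj pcaA)[]. Qed.

Lemma osndP v y : osnd v = Some y <-> exists x, v = pair_code x y.
Proof. by apply: opt_ofP => a b [c ->] [d] /(pair_code_inj pcaA)[]. Qed.

Definition oif v (a b : option A) : option A :=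
  if `[< v = num A 0 >] then a else if `[< v = num A 1 >] then b else None.

(** Call by value, except that the branch of [If] that is not selected may be undefined. *)
Fixpoint eval r t : option A :=
  match t with
  | Var n => onth r n
  | Cst a => Some (sval a)
  | Ap s t => obind (fun f => obind (app f) (eval r t)) (eval r s)
  | Pr s t => obind (fun a => omap (pair_code a) (eval r t)) (eval r s)
  | Fst t => obind ofst (eval r t)
  | Snd t => obind osnd (eval r t)
  | If s t u => obind (fun v => oif v (eval r t) (eval r u)) (eval r s)
  | La t => Some (closure t r)
  end.

Lemma compile_correct t r v : eval r t = Some v -> graph (compile t) (env_code r) v.
Proof.
elim: t r v => [n|a|s IHs t IHt|s IHs t IHt|t IHt|t IHt|s IHs t IHt u IHu|t IHt] r v /=.
- by move=> E; apply: pick_indexP; exists r.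
- by move=> [<-]; apply: pick_indexP.
- case Es: (eval r s) => [f|] //=; case Et: (eval r t) => [a|] //= Ef.
  apply: pick_indexP; exists (pair_code f a); last by exists f, a.
  by exists f, a; split=> //; [exact: IHs|exact: IHt].
- case Es: (eval r s) => [f|] //=; case Et: (eval r t) => [a|] //= [<-].
  by apply: pick_indexP; exists f, a; split=> //; [exact: IHs|exact: IHt].
- case Et: (eval r t) => [a|] //= /ofstP H.
  by apply: pick_indexP; exists a => //; exact: IHt.
- case Et: (eval r t) => [a|] //= /osndP H.
  by apply: pick_indexP; exists a => //; exact: IHt.
- case Es: (eval r s) => [a|] //= H; apply: pick_indexP.
  exists (pair_code a (env_code r)).
    by exists a, (env_code r); split=> //; exact: IHs.
  exists (env_code r); move: H; rewrite /oif; case: asboolP => [->|_].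
    by move=> /IHt; left.
  by case: asboolP => [->|_] // /IHu; right.
- by move=> [<-]; apply: pick_indexP.
Qed.

Lemma closure_app t r z v : eval (z :: r) t = Some v -> closure t r <*> z = Some v.
Proof. by move=> /compile_correct; apply: (s2valP' (curry_spec _)). Qed.

Lemma realize_term t : exists2 e, computable_elt A e &
  forall x v, eval [:: x] t = Some v -> e <*> x = Some v.
Proof.
have [e ce He] := realizable_comp pcaA (realizable_pair pcaA
  (realizable_const pcaA (num0_computable pcaA)) (realizable_id pcaA))
  (realizable_graph (compile t)).
exists e => // x v /compile_correct E; apply: He.
by exists (env_code [:: x]) => //; exists (num A 0), x.
Qed.

(** Fixed point by self-application; the inner abstraction delays the body, so [Rec t] always has a
    value. In [t], [Var 0] is the argument and [Self 1] the recursive function; each further binder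
    raises these indices by one. *)
Definition Rec t : term A := Ap (La (La t)) (La (La t)).
Definition Self (n : nat) : term A := Ap (Var n) (Var n).

Definition rec_self t r : A := closure (La t) r.
Definition rec_fun t r : A := closure t (rec_self t r :: r).

Lemma rec_self_app t r : rec_self t r <*> rec_self t r = Some (rec_fun t r).
Proof. exact: closure_app. Qed.

Lemma eval_Rec t r : eval r (Rec t) = Some (rec_fun t r).
Proof. exact: rec_self_app. Qed.

Lemma rec_fun_app t r x v :
  eval (x :: rec_self t r :: r) t = Some v -> rec_fun t r <*> x = Some v.
Proof. exact: closure_app. Qed.

Definition N0 : term A := Cst (exist _ _ (num0_computable pcaA)).
Definition N1 : term A := Cst (exist _ _ (num1_computable pcaA)).

Lemma ofst_pair x y : ofst (pair_code x y) = Some x.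
Proof. by apply/ofstP; exists y. Qed.

Lemma osnd_pair x y : osnd (pair_code x y) = Some y.
Proof. by apply/osndP; exists x. Qed.

Lemma oif0 (a b : option A) : oif (num A 0) a b = a.
Proof. by rewrite /oif asboolT. Qed.

Lemma oif1 (a b : option A) : oif (num A 1) a b = b.
Proof.
by rewrite /oif asboolF ?asboolT // => /esym; exact: num01.
Qed.

Definition evalE := (eval_Rec, rec_self_app, ofst_pair, osnd_pair, oif0, oif1).

Ltac simpl_eval := repeat progress rewrite /= ?evalE.

(** * Closure of a multimap *)

(* Computations with oracle [g]: [ret y] halts with output [y], [qry q k] puts the
   query [q] and goes on with [k <*> z] on the answer [z]. *)
Definition ret y : A := pair_code (num A 1) y.
Definition qry q k : A := pair_code (num A 0) (pair_code q k).

Lemma ret_inj y y' : ret y = ret y' -> y = y'.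
Proof. by move=> /(pair_code_inj pcaA)[]. Qed.

Lemma qry_inj q k q' k' : qry q k = qry q' k' -> q = q' /\ k = k'.
Proof. by move=> /(pair_code_inj pcaA)[_ /(pair_code_inj pcaA)]. Qed.

Lemma qry_ret q k y : qry q k <> ret y.
Proof. by move=> /(pair_code_inj pcaA)[/(num01 pcaA)]. Qed.

Implicit Types f g h U : multimap A.

(* [h] is there to avoid a nested inductive type. *)
Inductive succeeds g (B : set A) : A -> Prop :=
| succeeds_ret y : B y -> succeeds g B (ret y)
| succeeds_qry_fun q k (h : A -> A) : mdom g q ->
    (forall z, mval g q z -> k <*> z = Some (h z)) ->
    (forall z, mval g q z -> succeeds g B (h z)) -> succeeds g B (qry q k).

Lemma succeeds_qry g (B : set A) q k : mdom g q ->
  (forall z, mval g q z -> exists2 x, k <*> z = Some x & succeeds g B x) ->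
  succeeds g B (qry q k).
Proof.
move=> dq H; apply: (@succeeds_qry_fun g B q k (fun z => odflt k (k <*> z)) dq);
  by move=> z /H[x ->].
Qed.

Lemma succeeds_retE g (B : set A) y : succeeds g B (ret y) -> B y.
Proof.
move E: (ret y) => x H; case: x / H E => [y' By /ret_inj -> //|q k *].
by case: (@qry_ret q k y).
Qed.

Lemma succeeds_qryE g (B : set A) q k z x : succeeds g B (qry q k) ->
  mval g q z -> k <*> z = Some x -> succeeds g B x.
Proof.
move E: (qry q k) => v H; case: v / H E => [y' By /qry_ret //|q' k' h' _ Hk Hs].
move=> /qry_inj[-> ->] gz; rewrite Hk // => -[<-]; exact: Hs.
Qed.

Lemma succeeds_sub g (B C : set A) x : B `<=` C -> succeeds g B x -> succeeds g C x.
Proof.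
move=> BC; elim=> {x} [y /BC|q k h' dq Hk _ IH]; first exact: succeeds_ret.
exact: succeeds_qry_fun Hk IH.
Qed.

(** For [x] that succeeds at all this intersection is the least set for which it does, by
    [succeeds_outputs]. *)
Definition outputs g x : set A := [set y | forall B, succeeds g B x -> B y].

Lemma succeeds_outputs g (B : set A) x : succeeds g B x -> succeeds g (outputs g x) x.
Proof.
elim=> {x} [y _|q k h' dq Hk _ IH]; first by apply: succeeds_ret => C /succeeds_retE.
apply: (@succeeds_qry_fun g _ q k h') => // z gz; apply: succeeds_sub (IH z gz).
by move=> y Hy C HC; apply: Hy; exact: succeeds_qryE HC gz (Hk z gz).
Qed.

Definition closure_mmap g : multimap A := fun x =>
  if `[< succeeds g setT x >] then Some (outputs g x) else None.

(** Turns claims about domain and values of the closure into inductions on [succeeds]. *)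
Lemma closure_mmapP g (B : set A) x :
  mdom (closure_mmap g) x /\ mval (closure_mmap g) x `<=` B <-> succeeds g B x.
Proof.
rewrite /mdom /mval /= /closure_mmap; case: asboolP => [H|nH] /=; split.
- by move=> [_ sB]; apply: succeeds_sub (succeeds_outputs H).
- by move=> HB; split=> // y; exact.
- by case.
- by move=> /(succeeds_sub (subsetT B)).
Qed.

Lemma succeeds_mval g x : mdom (closure_mmap g) x ->
  succeeds g (mval (closure_mmap g) x) x.
Proof. by move=> dx; apply/closure_mmapP; split. Qed.

Lemma many_one_leP f g : many_one_le f g <->
  exists2 e, computable_elt A e & forall x, mdom f x ->
    exists y, [/\ e <*> x = Some y, mdom g y & mval g y `<=` mval f x].
Proof.
split=> [[h [e ce He] H]|[e ce He]].
  by exists e => // x /H[y [/He Hx gy sub]]; exists y.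
by exists (app e) => //; exists e.
Qed.

Lemma many_one_le_term f g t :
  (forall x, mdom f x -> exists y,
    [/\ eval [:: x] t = Some y, mdom g y & mval g y `<=` mval f x]) ->
  many_one_le f g.
Proof.
move=> H; apply/many_one_leP; have [e ce He] := realize_term t.
by exists e => // x /H[y [/He Ex gy sub]]; exists y.
Qed.

Lemma many_one_le_refl f : many_one_le f f.
Proof. by apply: (@many_one_le_term f f (Var 0)) => x dx; exists x; split. Qed.

Lemma many_one_le_trans g f h : many_one_le f g -> many_one_le g h -> many_one_le f h.
Proof.
move=> /many_one_leP[e ce He] /many_one_leP[d cd Hd].
apply: (@many_one_le_term f h
  (Ap (Cst (exist _ d cd)) (Ap (Cst (exist _ e ce)) (Var 0)))).
move=> x /He[y [Ex /Hd[z [Ey hz sz]] sy]]; exists z; rewrite /= Ex /= Ey; split=> //.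
exact: subset_trans sz sy.
Qed.

Lemma le_closure_mmap_term f g t :
  (forall x, mdom f x ->
    exists2 y, eval [:: x] t = Some y & succeeds g (mval f x) y) ->
  many_one_le f (closure_mmap g).
Proof.
move=> H; apply: (@many_one_le_term _ _ t) => x /H[y Ey /closure_mmapP[dy sy]].
by exists y.
Qed.

Lemma le_closure_mmap g : many_one_le g (closure_mmap g).
Proof.
apply: (@le_closure_mmap_term _ _ (Pr N0 (Pr (Var 0) (La (Pr N1 (Var 0)))))) => x dx.
eexists; first by []; apply: succeeds_qry => // z gz.
by exists (ret z); [exact: closure_app|exact: succeeds_ret].
Qed.

(** The program copies the computation tree of [x] and applies [a] to the output at each leaf. *)
Lemma closure_mmap_transparent g : computably_transparent (closure_mmap g).
Proof.
(* [Var 0] is the computation and [Var 2] is [a]. Under the inner abstraction [Var 0] is the answer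
   of the oracle, [Var 1] the computation and [Self 2] the recursive function. *)
pose body := If (Fst (Var 0))
  (Pr N0 (Pr (Fst (Snd (Var 0)))
             (La (Ap (Self 2) (Ap (Snd (Snd (Var 1))) (Var 0))))))
  (Pr N1 (Ap (Var 2) (Snd (Var 0)))).
have [u cu Hu] := realize_term (Rec body).
exists u => // a x B; case E : (closure_mmap g x) => [C|] //=.
rewrite /app_set; case: asboolP => // Ha [<-].
have dx : mdom (closure_mmap g) x by rewrite /mdom /= E.
have Cx : mval (closure_mmap g) x = C by rewrite /mval E.
rewrite /app2 (Hu a _ (eval_Rec _ _)) /=.
suff [y -> /closure_mmapP[]] : exists2 y, rec_fun body [:: a] <*> x = Some y &
    succeeds g [set y | exists2 b, C b & a <*> b = Some y] y by exists y.
have := succeeds_mval dx; rewrite Cx => {dx E Cx}.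
elim=> {x} [y Cy|q k h dq Hk _ IH].
  have := Ha _ Cy; case Ey : (a <*> y) => [v|] // _; exists (ret v).
    by apply: rec_fun_app; simpl_eval; rewrite Ey.
  by apply: succeeds_ret; exists y.
eexists; first by apply: rec_fun_app; simpl_eval.
apply: succeeds_qry => // z gz; have [w Ew sw] := IH z gz; exists w => //.
by apply: closure_app; simpl_eval; rewrite Hk.
Qed.

Lemma closure_mmap_inflationary g : inflationary_mmap (closure_mmap g).
Proof.
have [e ce He] := realize_term (Pr N1 (Var 0)); exists e => // x.
exists (ret x); have [] : mdom (closure_mmap g) (ret x) /\
  mval (closure_mmap g) (ret x) `<=` [set x]; last by split=> //; exact: He.
by apply/closure_mmapP/succeeds_ret.
Qed.

Lemma mdom_mcomp f g x :
  mdom (mcomp g f) x -> mdom f x /\ mval f x `<=` mdom g.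
Proof.
rewrite /mdom /mval /mcomp /=; case: (f x) => [B|] //=.
by case: asboolP.
Qed.

Lemma mcompE f g x : mdom f x -> mval f x `<=` mdom g ->
  mcomp g f x = Some (\bigcup_(y in mval f x) mval g y).
Proof.
by rewrite /mdom /mval /mcomp /=; case: (f x) => [B|] //= _; case: asboolP.
Qed.

(** Each leaf of the outer computation holds an inner computation, which is grafted in its place. *)
Lemma closure_mmap_idempotent g : idempotent_mmap (closure_mmap g).
Proof.
pose body := If (Fst (Var 0))
  (Pr N0 (Pr (Fst (Snd (Var 0)))
             (La (Ap (Self 2) (Ap (Snd (Snd (Var 1))) (Var 0))))))
  (Snd (Var 0)).
have key r B x : succeeds g [set y | succeeds g B y] x ->
    exists2 y, rec_fun body r <*> x = Some y & succeeds g B y.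
  elim=> {x} [y By|q k h dq Hk _ IH].
    by exists y => //; apply: rec_fun_app; simpl_eval.
  eexists; first by apply: rec_fun_app; simpl_eval.
  apply: succeeds_qry => // z gz; have [w Ew sw] := IH z gz; exists w => //.
  by apply: closure_app; simpl_eval; rewrite Hk.
have [mu cmu Hmu] := realize_term (Ap (Rec body) (Var 0)).
exists mu => // x /mdom_mcomp[dx sx].
rewrite [mval (mcomp _ _) _]/mval (mcompE dx sx) /=.
set B := \bigcup_(y in _) _.
have [|y Ey /closure_mmapP[dy sy]] := key [:: x] B x.
  apply: succeeds_sub (succeeds_mval dx) => y xy.
  by apply: succeeds_sub (succeeds_mval (sx y xy)) => z yz; exists y.
by exists y; split=> //; apply: Hmu; rewrite /= rec_self_app.
Qed.

Definition closed_mmap U : Prop :=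
  [/\ computably_transparent U, inflationary_mmap U & idempotent_mmap U].

Lemma closure_mmap_closed g : closed_mmap (closure_mmap g).
Proof.
split; [exact: closure_mmap_transparent|exact: closure_mmap_inflationary|].
exact: closure_mmap_idempotent.
Qed.

(** Recursion sends each computation to an instance of [U]: a halt through [eta], a query through
    [e], with [u] pushing the recursive calls inside [U] and [mu] flattening the nested values. *)
Lemma closure_mmap_least g U :
  closed_mmap U -> many_one_le g U -> many_one_le (closure_mmap g) U.
Proof.
move=> [[u cu Hu] [eta ceta Heta] [mu cmu Hmu]] /many_one_leP[e ce He].
pose cst (a : A) (ca : computable_elt A a) : term A := Cst (exist _ a ca).
pose body := If (Fst (Var 0))
  (Ap (cst _ cmu)
    (Ap (Ap (cst _ cu) (La (Ap (Self 2) (Ap (Snd (Snd (Var 1))) (Var 0)))))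
        (Ap (cst _ ce) (Fst (Snd (Var 0))))))
  (Ap (cst _ ceta) (Snd (Var 0))).
apply: (@many_one_le_term _ _ (Ap (Rec body) (Var 0))) => x0 /succeeds_mval.
move: (mval _ _) => B; rewrite [eval _ _]/= rec_self_app /=.
move: [:: x0] => r; elim=> {x0} [y By|q k h dq Hk _ IH].
  have [v [Ev dv sv]] := Heta y; exists v; split=> //.
    by apply: rec_fun_app; simpl_eval.
  by move=> w /sv ->.
have [q' [Eq' dq' sq']] := He q dq.
(* The value of the inner abstraction of [body]: from an answer to [q] it computes the instance of
   [U] assigned to the rest of the computation. *)
set c := closure (Ap (Self 2) (Ap (Snd (Snd (Var 1))) (Var 0)))
  (qry q k :: rec_self body r :: r).
have Hc z : mval U q' z ->
    exists y, [/\ c <*> z = Some y, mdom U y & mval U y `<=` B].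
  move=> /sq' gz; have [y [Ey dy sy]] := IH z gz; exists y; split=> //.
  by apply: closure_app; simpl_eval; rewrite Hk.
have [s [Es ds ss]] : exists s, [/\ app2 u c q' = Some s, mdom U s &
    mval U s `<=` [set y | exists2 z, mval U q' z & c <*> z = Some y]].
  apply: Hu; move: dq' Hc; rewrite /mdom /mval /=; case: (U q') => [C|] //= _ Hc.
  by rewrite /app_set asboolT // => z /Hc[y [-> _ _]].
have sU : mval U s `<=` mdom U.
  by move=> y /ss[z /Hc[y' [-> dy' _]] [<-]].
have [|y [Ey dy sy]] := Hmu s; first by rewrite /mdom /= mcompE.
exists y; split=> //.
  apply: rec_fun_app; simpl_eval; rewrite Eq' /=.
  by move: Es; rewrite /app2 -/c; case: (u <*> c) => [v|] //= ->.
move=> w /sy; rewrite /mval mcompE //= => -[v /ss[z /Hc[y' [-> _ sy']] [<-]]].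
exact: sy'.
Qed.

(** * Strategies *)

Lemma move_code_inj (m m' : action * A) : move_code m = move_code m' -> m = m'.
Proof.
case: m m' => [[] x] [[] y] /(pair_code_inj pcaA)[] /=.
- by move=> _ ->.
- by move/(num01 pcaA).
- by move/esym/(num01 pcaA).
- by move=> _ ->.
Qed.

Definition index_strategy (e : A) : strategy A :=
  fun s => opt_of (fun m => e <*> seq_code s = Some (move_code m)).

Lemma index_strategyP e s m :
  index_strategy e s = Some m <-> e <*> seq_code s = Some (move_code m).
Proof. by apply: opt_ofP => m1 m2 -> [/move_code_inj]. Qed.

Fixpoint after_answers x (s : seq A) x' : Prop :=
  if s is z :: s' then
    exists q k, x = qry q k /\
      exists2 x1, k <*> z = Some x1 & after_answers x1 s' x'
  else x = x'.

Lemma after_answers_rcons x s q k z x' : after_answers x s (qry q k) ->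
  k <*> z = Some x' -> after_answers x (rcons s z) x'.
Proof.
elim: s x => [|z0 s IH] x /=; first by move=> -> Ek; exists q, k; split=> //; exists x'.
move=> [q0 [k0 [-> [x1 Ex1 H]]]] Ek; exists q0, k0; split=> //.
by exists x1 => //; exact: IH.
Qed.

Lemma mkseqSl (T : Type) (z : nat -> T) n : mkseq z n.+1 = z 0 :: mkseq (z \o S) n.
Proof. by rewrite /mkseq /= (iotaDl 1 0) -map_comp. Qed.

(** In each round the strategy replays the computation assigned to [z 0] on all answers received so
    far and plays the move shown at the node reached. *)
Lemma turing_weihrauch_of_many_one f g :
  many_one_le f (closure_mmap g) -> turing_weihrauch_le f g.
Proof.
move=> /many_one_leP[e ce He].
(* [Var 0] is the list of answers still to be fed, [Var 1] the current computation; tag 0 marks the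
   empty list in the outer test and a query in the inner one. *)
pose step := If (Fst (Var 0))
  (If (Fst (Var 1)) (Pr N0 (Fst (Snd (Var 1)))) (Pr N1 (Snd (Var 1))))
  (Ap (Ap (Self 2) (Ap (Snd (Snd (Var 1))) (Fst (Snd (Var 0))))) (Snd (Snd (Var 0)))).
have stepE r x s x' m : after_answers x s x' ->
    (exists q k, x' = qry q k /\ m = (Query, q)) \/
    (exists2 y, x' = ret y & m = (Halt, y)) ->
    closure step (x :: rec_self (La step) r :: r) <*> seq_code s = Some (move_code m).
  elim: s x => [|z s IH] x /=.
    by move=> -> [[q [k [-> ->]]]|[y -> ->]]; apply: closure_app; simpl_eval.
  move=> [q0 [k0 [-> [x1 Ex1 /IH{}IH]]]] /IH E.
  by apply: closure_app; simpl_eval; rewrite Ex1 /=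
    (@rec_fun_app (La step) r x1 _ erefl).
have [d cd Hd] := realize_term (Ap
  (Ap (Rec (La step)) (Ap (Cst (exist _ e ce)) (Fst (Snd (Var 0)))))
  (Snd (Snd (Var 0)))).
exists (index_strategy d); first by exists d => // s m /index_strategyP.
move=> z; case: (pselect (mdom f (z 0))) => [fz|nfz]; last by exists 0 => //; left.
have [x0 [Ex0 dx0 sx0]] := He _ fz.
have strategyE n x m : after_answers x0 (mkseq (z \o S) n) x ->
    (exists q k, x = qry q k /\ m = (Query, q)) \/
    (exists2 y, x = ret y & m = (Halt, y)) ->
    computer_move (index_strategy d) z n = Some m.
  move=> Hx Hm; apply/index_strategyP; rewrite mkseqSl; apply: Hd.
  simpl_eval; rewrite Ex0 /= (@rec_fun_app (La step) _ x0 _ erefl) /=.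
  exact: stepE Hx Hm.
(* Each round descends to a child in the well-founded tree of [x], so the induction excludes
   infinite legal plays. *)
suff main x : succeeds g (mval f (z 0)) x -> forall n,
    reaches f g (index_strategy d) z n -> oracle_legal f g (index_strategy d) z n ->
    after_answers x0 (mkseq (z \o S) n) x -> computer_wins f g (index_strategy d) z.
  by apply: (main x0 _ 0) => //; apply/closure_mmapP.
elim=> {x} [y By|q k h dq Hk _ IH] n rn ln Hx.
  exists n => //; right; exists y => //.
  by apply: strategyE Hx _; right; exists y.
have move_n : computer_move (index_strategy d) z n = Some (Query, q).
  by apply: strategyE Hx _; left; exists q, k.
have rn1 : reaches f g (index_strategy d) z n.+1.
  move=> m; rewrite ltnS leq_eqVlt => /orP[/eqP ->|/rn //].
  by split=> //; exists q.
case: (pselect (oracle_legal f g (index_strategy d) z n.+1)) => [ln1|nl]; last first.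
  by exists n.+1 => //; left.
have gz : mval g q (z n.+1) by case: ln1 => q'; rewrite move_n => -[<-].
apply: (IH _ gz n.+1) => //; rewrite mkseqS; exact: (after_answers_rcons Hx (Hk _ gz)).
Qed.

(** Being inductive, this contains only positions from which every play with legal answers halts
    after finitely many rounds. *)
Inductive winning_position g (tau : strategy A) (B : set A) : seq A -> Prop :=
| winning_halt s y : tau s = Some (Halt, y) -> B y -> winning_position g tau B s
| winning_query s q : tau s = Some (Query, q) -> mdom g q ->
    (forall z, mval g q z -> winning_position g tau B (rcons s z)) ->
    winning_position g tau B s.

(** If the start were lost, every legal query at a lost position would have an answer leading to
    another lost position; iterating such answers gives a play not won by Computer. *)
Lemma winning_start f g (tau : strategy A) z0 :
  (forall z : nat -> A, computer_wins f g tau z) -> mdom f z0 ->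
  winning_position g tau (mval f z0) [:: z0].
Proof.
move=> wins dz0; apply: contrapT => lost.
pose W := winning_position g tau (mval f z0).
pose bad s z := exists q, [/\ tau s = Some (Query, q), mval g q z & ~ W (rcons s z)].
(* A choice of such an answer, with default [z0] where there is none. *)
pose next s : A := if pselect (exists z, bad s z) is left h then sval (cid h) else z0.
have nextP s q : tau s = Some (Query, q) -> mdom g q -> ~ W s -> bad s (next s).
  move=> ts dq nW; rewrite /next; case: pselect => [h|nbad]; first exact: svalP (cid h).
  case: nW; apply: (winning_query ts dq) => z gz; apply: contrapT => nW.
  by case: nbad; exists z, q.
pose pos n := iter n (fun s => rcons s (next s)) [:: z0].
pose z n := last z0 (pos n).
have posE n : mkseq z n.+1 = pos n.
  by elim: n => // n IH; rewrite mkseqS IH /z /= last_rcons.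
have [n rn fin] := wins z.
(* Up to the round [n] of the supposed win Oracle stays legal and the position stays lost, which
   rules out a correct halt at [n]. *)
have inv m : m <= n -> oracle_legal f g tau z m /\ ~ W (pos m).
  elim: m => [|m IH] lt; first by split.
  have [lm nWm] := IH (ltnW lt); have [_ [q Eq dq]] := rn m lt.
  move: (Eq); rewrite /computer_move posE => Eq'.
  have [q' [Eq'' gz nW]] := nextP _ _ Eq' dq nWm; split=> //.
  by exists q'; rewrite /computer_move ?posE // /z /= last_rcons.
have [ln nW] := inv n (leqnn n); case: fin => // -[y].
rewrite /computer_move posE => ty fy; apply: nW; exact: winning_halt fy.
Qed.

(** The computation assigned to [z0] imitates the strategy move by move. The history is kept as a
    function prepending it, so that an answer is added at its end without traversing the list. *)
Lemma many_one_of_turing_weihrauch f g :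
  turing_weihrauch_le f g -> many_one_le f (closure_mmap g).
Proof.
move=> [tau [e ce He] wins].
pose nil_term := Pr N0 N0; pose cons_term s t : term A := Pr N1 (Pr s t).
pose move_term := Ap (Cst (exist _ e ce)) (Ap (Var 0) nil_term).
(* The program is applied to [p] with [p <*> seq_code l = seq_code (s ++ l)],
   where [s] is the current position. *)
pose prepend := Ap (Var 2) (cons_term (Var 1) (Var 0)).
pose body := If (Fst move_term)
  (Pr N0 (Pr (Snd move_term) (La (Ap (Self 2) (La prepend)))))
  (Pr N1 (Snd move_term)).
pose codes (p : A) s := forall l, p <*> seq_code l = Some (seq_code (s ++ l)).
have bodyE r (B : set A) s : winning_position g tau B s ->
    forall p, codes p s ->
    exists2 x, rec_fun body r <*> p = Some x & succeeds g B x.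
  elim=> {s} [s y /He Es By|s q /He Es dq _ IH] p Hp.
    have := Hp [::]; rewrite cats0 => Hnil; exists (ret y); last exact: succeeds_ret.
    by apply: rec_fun_app; simpl_eval; rewrite Hnil /= Es; simpl_eval.
  have := Hp [::]; rewrite cats0 => Hnil.
  eexists; first by apply: rec_fun_app; simpl_eval; rewrite Hnil /= Es; simpl_eval.
  apply: succeeds_qry => // z gz.
  (* Consing [z] before applying [p] represents the position [rcons s z]. *)
  have [|x Ex sx] := IH z gz (closure prepend [:: z, p, rec_self body r & r]).
    by move=> l; apply: closure_app => /=; rewrite cat_rcons -Hp.
  by exists x => //; apply: closure_app; simpl_eval.
apply: (@le_closure_mmap_term _ _
  (Ap (Rec body) (La (cons_term (Var 1) (Var 0))))) => z0 dz0.
have [|x Ex sx] := bodyE [:: z0] _ _ (winning_start wins dz0)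
  (closure (cons_term (Var 1) (Var 0)) [:: z0]).
  by move=> l; apply: closure_app.
by exists x => //; simpl_eval.
Qed.

Lemma turing_weihrauch_leP f g :
  turing_weihrauch_le f g <-> many_one_le f (closure_mmap g).
Proof.
by split; [exact: many_one_of_turing_weihrauch|exact: turing_weihrauch_of_many_one].
Qed.

(** A closed [U] is many-one equivalent to its closure, by leastness applied to the reflexive
    reduction. *)
Lemma turing_weihrauch_le_closed f U :
  closed_mmap U -> turing_weihrauch_le f U <-> many_one_le f U.
Proof.
move=> cU; rewrite turing_weihrauch_leP; split=> /many_one_le_trans; apply.
  exact: closure_mmap_least (many_one_le_refl U).
exact: le_closure_mmap.
Qed.

Lemma turing_weihrauch_le_refl f : turing_weihrauch_le f f.
Proof. exact/turing_weihrauch_leP/le_closure_mmap. Qed.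

Lemma turing_weihrauch_le_trans g f h :
  turing_weihrauch_le f g -> turing_weihrauch_le g h -> turing_weihrauch_le f h.
Proof.
rewrite !turing_weihrauch_leP => fg gh; apply: many_one_le_trans fg _.
exact: closure_mmap_least (closure_mmap_closed h) gh.
Qed.

(** Provides a closed representative in every Turing-Weihrauch degree. *)
Lemma closure_mmap_equiv g :
  turing_weihrauch_le g (closure_mmap g) /\ turing_weihrauch_le (closure_mmap g) g.
Proof.
split; last exact/turing_weihrauch_leP/many_one_le_refl.
apply/(turing_weihrauch_le_closed _ (closure_mmap_closed g)); exact: le_closure_mmap.
Qed.

End Terms.

(** * Degrees *)

Section Degrees.
Variables (T : Type) (P : set T) (le : T -> T -> Prop).
Hypothesis le_refl : forall f, le f f.
Hypothesis le_trans : forall g f h, le f g -> le g h -> le f h.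
Implicit Types (c d : degree P le).

Definition degree_of (f : T) (Pf : P f) : degree P le :=
  exist _ [set g | P g /\ le f g /\ le g f]
    (ex_intro2 (fun f => P f) (fun f' => _ = [set g | P g /\ le f' g /\ le g f'])
       f Pf erefl).

Definition degree_rep c : T := s2val (cid2 (svalP c)).

Lemma degree_repP c : P (degree_rep c).
Proof. exact: s2valP (cid2 (svalP c)). Qed.

Lemma degree_val c :
  sval c = [set g | P g /\ le (degree_rep c) g /\ le g (degree_rep c)].
Proof. exact: s2valP' (cid2 (svalP c)). Qed.

Lemma degree_leE c d : degree_le c d <-> le (degree_rep c) (degree_rep d).
Proof.
rewrite /degree_le !degree_val; split.
  by move=> [f [g [[_ [cf _]] [_ [_ gd]] fg]]]; exact: le_trans (le_trans cf fg) gd.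
move=> cd; exists (degree_rep c), (degree_rep d).
by split=> //; split=> //; exact: degree_repP.
Qed.

Lemma degree_eq c d :
  le (degree_rep c) (degree_rep d) -> le (degree_rep d) (degree_rep c) -> c = d.
Proof.
move=> cd dc; have : sval c = sval d.
  by rewrite !degree_val; apply/seteqP; split=> f /= [Pf [H1 H2]]; split=> //;
    split; eauto.
by case: c d {cd dc} => [c hc] [d hd] /=; exact: eq_exist.
Qed.

Lemma degree_rep_of (f : T) (Pf : P f) :
  le f (degree_rep (degree_of Pf)) /\ le (degree_rep (degree_of Pf)) f.
Proof.
have : sval (degree_of Pf) (degree_rep (degree_of Pf)).
  by rewrite degree_val; split=> //; exact: degree_repP.
by case.
Qed.

End Degrees.

(** [F] takes the [le2] class of a representative and [G] the [le1] class of an equivalent element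
    of [P]. Since the orders agree on [P], all comparisons can be made in [le2]. *)
Lemma degrees_isomorphic (T : Type) (P Q : set T) (le1 le2 : T -> T -> Prop) :
  (forall f, le1 f f) -> (forall g f h, le1 f g -> le1 g h -> le1 f h) ->
  (forall f, le2 f f) -> (forall g f h, le2 f g -> le2 g h -> le2 f h) ->
  P `<=` Q -> (forall f g, P f -> P g -> le1 f g <-> le2 f g) ->
  (forall g, Q g -> exists2 f, P f & le2 g f /\ le2 f g) ->
  order_isomorphic (@degree_le T P le1) (@degree_le T Q le2).
Proof.
move=> r1 t1 r2 t2 PQ le12 closeP.
pose F (c : degree P le1) : degree Q le2 := degree_of le2 (PQ _ (degree_repP c)).
pose close (d : degree Q le2) := cid2 (closeP _ (degree_repP d)).
pose G (d : degree Q le2) : degree P le1 := degree_of le1 (s2valP (close d)).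
have repF c : le2 (degree_rep c) (degree_rep (F c)) /\
    le2 (degree_rep (F c)) (degree_rep c).
  exact: degree_rep_of.
have repG d := degree_rep_of r1 (s2valP (close d)).
have repG2 d : le2 (degree_rep d) (degree_rep (G d)) /\
    le2 (degree_rep (G d)) (degree_rep d).
  have [dc cd] := s2valP' (close d); have [cG Gc] := repG d.
  have PG := degree_repP (G d); have Pc := s2valP (close d).
  by split; [apply: t2 dc _|apply: t2 cd]; apply/le12.
have leF c d : degree_le c d <-> degree_le (F c) (F d).
  rewrite !degree_leE //; have [a b] := repF c; have [a' b'] := repF d.
  rewrite le12; try exact: degree_repP.
  by split=> H; [apply: t2 (t2 _ _ _ b H) a'|apply: t2 (t2 _ _ _ a H) b'].
exists F => //; exists G => [c|d]; apply: degree_eq => //.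
- have [a b] := repF c; have [a' b'] := repG2 (F c).
  by apply/le12; [exact: degree_repP|exact: degree_repP|exact: t2 b' b].
- have [a b] := repF c; have [a' b'] := repG2 (F c).
  by apply/le12; [exact: degree_repP|exact: degree_repP|exact: t2 a a'].
- have [a b] := repF (G d); have [a' b'] := repG2 d; exact: t2 b b'.
- have [a b] := repF (G d); have [a' b'] := repG2 d; exact: t2 a' a.
Qed.

Lemma pca_degrees_isomorphic (A : algebra) : pca A ->
  order_isomorphic (@many_one_degree_le A [set U | closed_mmap U])
    (@turing_weihrauch_degree_le A).
Proof.
move=> pcaA; apply: degrees_isomorphic.
- exact: many_one_le_refl.
- exact: many_one_le_trans.
- exact: turing_weihrauch_le_refl.
- exact: turing_weihrauch_le_trans.
- exact: subsetT.
- move=> f U _ cU; apply: iff_sym; exact: turing_weihrauch_le_closed.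
- move=> g _; exists (closure_mmap g); first exact: closure_mmap_closed.
  exact: closure_mmap_equiv.
Qed.

Theorem corollary2p19 (A : algebra)
  (hA : [\/ A = kleene_first, A = kleene_second | A = kleene_vesley]) :
  order_isomorphic
    (@many_one_degree_le A
       [set U : multimap A | [/\ computably_transparent U, inflationary_mmap U
                              & idempotent_mmap U]])
    (@turing_weihrauch_degree_le A).
Proof.
apply: pca_degrees_isomorphic; case: hA => ->.
- exact: pca_kleene_first.
- rewrite baire_secondE; exact: pca_baire.
- rewrite baire_vesleyE; exact: pca_baire.
Qed.
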